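(* Let $\mathbb{F}_{p^s}$ be a finite extension of $\mathbb{F}_q$ and let $g=p^h(p-1)/2$ be the genus of $C_R$ (here $h\ge 0$). Put $a=a_{\mathcal A}$ for some choice of a maximal abelian subgroup $\mathcal A$ of $P$. Then the $L$-polynomial of $C_R$ over $\mathbb{F}_{p^s}$ is as follows. 1. If $p\equiv 1 \pmod 4$, then $$L_{C_R,\mathbb{F}_{p^s}}(T)=\begin{cases}(1-p^sT^2)^g & \text{if } s \text{ is odd},\\ (1-p^{s/2}T)^{2g} & \text{if } s \text{ is even and } a \text{ is a square in } \mathbb{F}_{p^s}^*,\\ (1+p^{s/2}T)^{2g} & \text{if } s \text{ is even and } a \text{ is a nonsquare in } \mathbb{F}_{p^s}^*.\end{cases}$$ 2. If $p\equiv 3 \pmod 4$, then $$L_{C_R,\mathbb{F}_{p^s}}(T)=\begin{cases}(1+p^sT^2)^g & \text{if } s \text{ is odd},\\ (1-p^{s/2}T)^{2g} & \text{if } s\equiv 0 \pmod 4 \text{ and } a \text{ is a square in } \mathbb{F}_{p^s}^*,\\ (1+p^{s/2}T)^{2g} & \text{if } s\equiv 0 \pmod 4 \text{ and } a \text{ is a nonsquare in } \mathbb{F}_{p^s}^*,\\ (1+p^{s/2}T)^{2g} & \text{if } s\equiv 2 \pmod 4 \text{ and } a \text{ is a square in } \mathbb{F}_{p^s}^*,\\ (1-p^{s/2}T)^{2g} & \text{if } s\equiv 2 \pmod 4 \text{ and } a \text{ is a nonsquare in } \mathbb{F}_{p^s}^*.\end{cases}$$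
   Context: Let $p$ be an odd prime, $k=\overline{\mathbb{F}}_p$, $h\ge 0$, and $R(X)=\sum_{i=0}^h a_iX^{p^i}\in\mathbb{F}_{p^r}[X]$ with $a_h\neq 0$ (an additive polynomial of degree $p^h$). $C_R$ is the smooth projective absolutely irreducible curve over $\mathbb{F}_{p^r}$ with affine equation $Y^p-Y=XR(X)$; it has a unique point $\infty$ at infinity. Put $E(X)=R(X)^{p^h}+\sum_{i=0}^h (a_iX)^{p^{h-i}}\in\mathbb{F}_{p^r}[X]$, let $W=\{c\in k: E(c)=0\}$ (an $\mathbb{F}_p$-vector space of dimension $2h$), and let $\mathbb{F}_q\supseteq\mathbb{F}_{p^r}$ be the splitting field of $E$ over $\mathbb{F}_{p^r}$. For $c\in W$ let $B_c(X)\in Xk[X]$ be the unique polynomial with zero constant term satisfying $B_c(X)^p-B_c(X)=cR(X)+R(c)X$. For $c\in W$ and $b\in k$ with $b^p-b=cR(c)$, let $\sigma_{b,c}$ be the automorphism $(x,y)\mapsto(x+c,\,y+b+B_c(x))$ of $C_R$. $P$ is the group of all such $\sigma_{b,c}$; it is the unique Sylow $p$-subgroup of the group of $k$-automorphisms of $C_R$ fixing $\infty$. For a maximal abelian subgroup $\mathcal A$ of $P$, let $\overline A\subseteq W$ be its image under $P\to W$, $\sigma_{b,c}\mapsto c$. Define $$a_{\mathcal A}=\frac{a_h}{2}\prod_{c\in\overline A\setminus\{0\}}c\quad\text{if } h\ge 1,\qquad a_{\mathcal A}=a_0\quad\text{if } h=0.$$ For a curve $C$ over $\mathbb{F}_{p^s}$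 of genus $g$, the zeta function $Z_C(T)=\exp\left(\sum_{n\ge1}\#C(\mathbb{F}_{p^{sn}})T^n/n\right)$ equals $L_{C,\mathbb{F}_{p^s}}(T)/((1-T)(1-p^sT))$, where $L_{C,\mathbb{F}_{p^s}}(T)\in\mathbb{Z}[T]$ has degree $2g$ and constant term $1$ and is called the $L$-polynomial of $C$ over $\mathbb{F}_{p^s}$. *)

(* Defs.v *)
From HB Require Import structures.
From mathcomp Require Import all_boot all_order all_algebra all_fingroup all_field.
From mathcomp Require Import ring.

Set Implicit Arguments.
Unset Strict Implicit.
Unset Printing Implicit Defensive.

Import GRing.Theory.
Local Open Scope ring_scope.

Section Zeros.

Variable k : closedFieldType.

(* The distinct roots in k of f; only meaningful for f != 0. *)
Definition zeros (f : {poly k}) : seq k :=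
  undup (sval (closed_field_poly_normal f)).

Lemma zeros_uniq f : uniq (zeros f).
Proof. exact: undup_uniq. Qed.

Lemma mem_zeros f x : f != 0 -> (x \in zeros f) = root f x.
Proof.
move=> f_neq0; rewrite mem_undup; case: closed_field_poly_normal => r /= Df.
by rewrite Df rootZ ?lead_coef_eq0 // root_prod_XsubC.
Qed.

End Zeros.

Section GaloisField.

Variables (p : nat) (k : closedFieldType).

(* For m > 0 and k of characteristic p, the elements of the unique subfield
   of k with p ^ m elements. *)
Definition GF (m : nat) : seq k := zeros ('X^(p ^ m) - 'X).

Lemma mem_GF m x : prime p -> (0 < m)%N -> (x \in GF m) = (x ^+ (p ^ m) == x).
Proof.
move=> p_pr m_gt0; have pm_gt1: (1 < p ^ m)%N.
  by rewrite -(exp1n m) ltn_exp2r ?prime_gt1.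
rewrite mem_zeros; first by rewrite rootE !hornerE subr_eq0.
apply: contraNneq (oner_neq0 k) => /(congr1 (fun f : {poly k} => f`_(p ^ m))).
rewrite coefB coefXn coefX coef0 eqxx gtn_eqF // subr0 => /eqP.
by [].
Qed.

(* The elements of F_(p^m)^* which are squares in F_(p^m)^*. *)
Definition square_in (m : nat) (x : k) : Prop :=
  exists z, [/\ z \in GF m, z != 0 & x = z ^+ 2].

Definition splits_over (f : {poly k}) (m : nat) : Prop :=
  exists2 rs : seq k, f %= \prod_(z <- rs) ('X - z%:P) & {subset rs <= GF m}.

(* F_(p^e) is the splitting field over F_(p^r) of f, i.e., the smallest
   extension of F_(p^r) inside k over which f splits. *)
Definition splitting_field (r : nat) (f : {poly k}) (e : nat) : Prop :=
  [/\ (0 < e)%N, {subset GF r <= GF e}, splits_over f e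
    & forall m, (0 < m)%N -> {subset GF r <= GF m} -> splits_over f m ->
        {subset GF e <= GF m}].

End GaloisField.

Section Zeta.

Local Open Scope nat_scope.

(* The coefficient of T^n in exp (\sum_(m >= 1) N m * T^m / m); the terms
   dropped in either sum only contribute to higher powers of T. *)
Definition zeta_coef (N : nat -> nat) (n : nat) : rat :=
  (\sum_(0 <= j < n.+1) (j`!%:R)^-1 *:
     (\sum_(1 <= m < n.+1) ((N m)%:R / m%:R) *: 'X^m) ^+ j : {poly rat})%R`_n.

(* Z(T) = L(T) / ((1 - T)(1 - qT)) for the zeta function Z of a curve with
   N m points over the extension of degree m of F_q, as an identity between
   the coefficients of the power series Z(T)(1 - T)(1 - qT) and L(T). *)
Definition is_Lpoly (q : nat) (N : nat -> nat) (L : {poly int}) : Prop :=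
  forall n : nat, (\sum_(i < n.+1) zeta_coef N i *
      ((1 - 'X) * (1 - q%:R *: 'X) : {poly rat})`_(n - i) = (L`_n)%:~R :> rat)%R.

End Zeta.

Section Curve.

Variables (p : nat) (k : closedFieldType) (h : nat) (a : 'I_h.+1 -> k).

Definition Rpoly : {poly k} := \sum_(i < h.+1) a i *: 'X^(p ^ i).

Definition Epoly : {poly k} :=
  Rpoly ^+ (p ^ h) + \sum_(i < h.+1) (a i *: 'X) ^+ (p ^ (h - i)).

(* The affine curve Y^p - Y = X R(X) is smooth and C_R has a single further
   point, at infinity, so C_R(k) consists of None (infinity) and of the
   Some (x, y) with (x, y) on the affine curve. *)
Definition on_curve (P : option (k * k)) : bool :=
  if P is Some (x, y) then y ^+ p - y == x * Rpoly.[x] else true.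

(* C_R(F_(p^m)); infinity is the only point of C_R outside the affine part,
   hence is rational. *)
Definition curve_points (m : nat) : seq (option (k * k)) :=
  [seq P <- None :: [seq Some (x, y) | x <- GF p k m, y <- GF p k m]
     | on_curve P].

Definition is_curve_Lpoly (s : nat) (L : {poly int}) : Prop :=
  is_Lpoly (p ^ s) (fun n => size (curve_points (s * n))) L.

Definition is_Bpoly (c : k) (B : {poly k}) : bool :=
  (B`_0 == 0) && (B ^+ p - B == c *: Rpoly + Rpoly.[c] *: 'X).

Definition aut_pair (u : k * k) : bool :=
  root Epoly u.2 && (u.1 ^+ p - u.1 == u.2 * Rpoly.[u.2]).

Section CharP.

Hypotheses (p_pr : prime p) (iota : {rmorphism 'F_p -> k}).

Let pchark : p \in [pchar k] := rmorph_pchar iota (pchar_Fp p_pr).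

Let p_gt0 : (0 < p)%N := prime_gt0 p_pr.

Lemma expD (A : comNzRingType) (x y : A) i : p \in [pchar A] ->
  (x + y) ^+ (p ^ i) = x ^+ (p ^ i) + y ^+ (p ^ i).
Proof. by move=> pA; apply: exprDn_pchar; rewrite pnatX pnatE ?pA. Qed.

Lemma expB (A : comNzRingType) (x y : A) i : p \in [pchar A] ->
  (x - y) ^+ (p ^ i) = x ^+ (p ^ i) - y ^+ (p ^ i).
Proof.
by move=> pA; apply/eqP; rewrite eq_sym subr_eq -expD // subrK.
Qed.

Lemma exp_sum (A : comNzRingType) (I : Type) (r : seq I) (F : I -> A) i :
  p \in [pchar A] ->
  (\sum_(j <- r) F j) ^+ (p ^ i) = \sum_(j <- r) F j ^+ (p ^ i).
Proof.
move=> pA; elim: r => [|j r IHr]; last by rewrite !big_cons expD // IHr.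
by rewrite !big_nil expr0n gtn_eqF // expn_gt0 p_gt0.
Qed.

Lemma pcharP : p \in [pchar {poly k}].
Proof. exact: (rmorph_pchar (polyC : {rmorphism k -> {poly k}}) pchark). Qed.

Lemma RpolyE x : Rpoly.[x] = \sum_(i < h.+1) a i * x ^+ (p ^ i).
Proof.
by rewrite horner_sum; apply: eq_bigr => i _; rewrite hornerZ hornerXn.
Qed.

Lemma EpolyE x :
  Epoly.[x] = Rpoly.[x] ^+ (p ^ h) + \sum_(i < h.+1) (a i * x) ^+ (p ^ (h - i)).
Proof.
rewrite hornerD horner_exp; congr (_ + _); rewrite horner_sum.
by apply: eq_bigr => i _; rewrite horner_exp hornerZ hornerX.
Qed.

Lemma RpolyD x y : Rpoly.[x + y] = Rpoly.[x] + Rpoly.[y].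
Proof.
rewrite !RpolyE -big_split; apply: eq_bigr => i _ /=.
by rewrite expD // mulrDr.
Qed.

Lemma EpolyD x y : Epoly.[x + y] = Epoly.[x] + Epoly.[y].
Proof.
rewrite !EpolyE RpolyD expD // addrACA; congr (_ + _).
by rewrite -big_split; apply: eq_bigr => i _; rewrite mulrDr expD.
Qed.

Lemma Rpoly0 : Rpoly.[0] = 0.
Proof. by apply: (addrI Rpoly.[0]); rewrite -RpolyD !addr0. Qed.

Lemma Epoly0 : Epoly.[0] = 0.
Proof. by apply: (addrI Epoly.[0]); rewrite -EpolyD !addr0. Qed.

Lemma RpolyN x : Rpoly.[- x] = - Rpoly.[x].
Proof. by apply: (addrI Rpoly.[x]); rewrite -RpolyD !subrr Rpoly0. Qed.

Lemma EpolyN x : Epoly.[- x] = - Epoly.[x].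
Proof. by apply: (addrI Epoly.[x]); rewrite -EpolyD !subrr Epoly0. Qed.

Lemma frob_poly0 (f : {poly k}) : f ^+ p - f = 0 -> f.[0] = 0 -> f = 0.
Proof.
move/eqP; rewrite subr_eq0 => /eqP fp f0.
have [] := leqP (size f) 1.
  by move/size1_polyC=> Df; rewrite Df hornerC in f0 *; rewrite f0.
move=> f_gt1; have f_neq0: f != 0 by rewrite -size_poly_gt0 ltnW.
have:= congr1 (fun g : {poly k} => (size g).-1) fp.
rewrite size_exp => /eqP.
by rewrite -[X in _ == X]muln1 eqn_pmul2l ?gtn_eqF ?prime_gt1 // -subn1 subn_gt0.
Qed.

Lemma asB (f g : {poly k}) :
  (f - g) ^+ p - (f - g) = (f ^+ p - f) - (g ^+ p - g).
Proof. by have:= expB f g 1 pcharP; rewrite expn1 => ->; ring. Qed.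

Lemma asD (f g : {poly k}) :
  (f + g) ^+ p - (f + g) = (f ^+ p - f) + (g ^+ p - g).
Proof. by have:= expD f g 1 pcharP; rewrite expn1 => ->; ring. Qed.

Lemma is_Bpoly_inj c B1 B2 : is_Bpoly c B1 -> is_Bpoly c B2 -> B1 = B2.
Proof.
case/andP=> /eqP B10 /eqP B1p /andP[/eqP B20 /eqP B2p].
apply/eqP; rewrite -subr_eq0; apply/eqP/frob_poly0.
  by rewrite asB B1p B2p subrr.
by rewrite horner_coef0 coefB B10 B20 subrr.
Qed.

Lemma is_BpolyD c1 c2 B1 B2 :
  is_Bpoly c1 B1 -> is_Bpoly c2 B2 -> is_Bpoly (c1 + c2) (B1 + B2).
Proof.
case/andP=> /eqP B10 /eqP B1p /andP[/eqP B20 /eqP B2p].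
rewrite /is_Bpoly coefD B10 B20 addr0 eqxx /= asD B1p B2p RpolyD !scalerDl.
by rewrite addrACA.
Qed.

Lemma comp_Rpoly y : Rpoly \Po ('X + y%:P) = Rpoly + (Rpoly.[y])%:P.
Proof.
rewrite RpolyE raddf_sum rmorph_sum -big_split /=; apply: eq_bigr => i _.
rewrite comp_polyZ comp_Xn_poly expD ?pcharP // scalerDr; congr (_ + _).
by rewrite -polyC_exp -mul_polyC -polyCM.
Qed.

Lemma hornerBD c B x y : is_Bpoly c B -> B.[x + y] = B.[x] + B.[y].
Proof.
case/andP=> /eqP B0 /eqP Bp.
have Byp: B.[y] ^+ p - B.[y] = c * Rpoly.[y] + Rpoly.[c] * y.
  by have:= congr1 (horner^~ y) Bp; rewrite !hornerE.
have: B \Po ('X + y%:P) - (B + B.[y]%:P) = 0.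
  apply: frob_poly0; last first.
    by rewrite !hornerE horner_comp !hornerE horner_coef0 B0 add0r subrr.
  rewrite asB -rmorphXn -rmorphB /= Bp rmorphD /= !comp_polyZ comp_Rpoly comp_polyX.
  rewrite asD Bp -polyC_exp -polyCB Byp.
  by rewrite polyCD !polyCM -!mul_polyC; ring.
move/(congr1 (horner^~ x)); rewrite !hornerE horner_comp !hornerE => /eqP.
by rewrite subr_eq0 => /eqP.
Qed.

Lemma Bpoly_exists c : root Epoly c -> exists B : {poly k}, is_Bpoly c B.
Proof.
move=> /eqP Ec; pose a' i := if insub i is Some j then a j else 0.
have a'E (i : 'I_h.+1) : a' i = a i by rewrite /a' valK.
pose b n : k := - (Rpoly.[c] ^+ (p ^ n) +
                   \sum_(i < n.+1) (a' i * c) ^+ (p ^ (n - i))).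
have bS n : b n.+1 = b n ^+ p - c * a' n.+1.
  have:= expB 0 (- b n) 1 pchark; rewrite !sub0r opprK expn1.
  rewrite expr0n gtn_eqF // sub0r => ->.
  rewrite {2}/b opprK -[X in _ ^+ X]expn1 expD // exp_sum // -exprM -expnSr.
  rewrite /b big_ord_recr /= subnn expn0 expr1 addrA opprD; congr (- _ - _).
    congr (_ + _); apply: eq_bigr => i _.
    by rewrite -exprM -expnSr subSn // -ltnS.
  exact: mulrC.
have bh : b h = 0.
  apply/eqP; rewrite oppr_eq0 -[X in _ == X]Ec EpolyE; apply/eqP; congr (_ + _).
  by apply: eq_bigr => i _; rewrite a'E.
pose S n : {poly k} := \sum_(i < n) b i *: 'X^(p ^ i).
have SP n : S n ^+ p - S n = c *: \sum_(i < n.+1) a' i *: 'X^(p ^ i)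
   + Rpoly.[c] *: 'X + b n *: 'X^(p ^ n).
  elim: n => [|n IHn].
    rewrite /S big_ord0 expr0n gtn_eqF // subr0 big_ord_recl big_ord0 addr0.
    rewrite /b big_ord_recl big_ord0 addr0 subnn !expn0 !expr1 scaleNr scalerDl.
    by rewrite mulr0n scalerA [c * _]mulrC -!mul_polyC; ring.
  rewrite /S big_ord_recr /= -/(S n) asD IHn.
  rewrite [in RHS]big_ord_recr /= bS exprZn -exprM -expnSr.
  by rewrite scalerDr scalerBl scalerA; ring.
exists (S h); apply/andP; split.
  rewrite /S coef_sum big1 // => i _.
  by rewrite coefZ coefXn ltn_eqF ?mulr0 // expn_gt0 p_gt0.
rewrite SP bh scale0r addr0; apply/eqP; congr (c *: _ + _).
by apply: eq_bigr => i _; rewrite a'E.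
Qed.

Definition Bpoly (c : k) (Wc : root Epoly c) : {poly k} :=
  xchoose (Bpoly_exists Wc).

Lemma BpolyP c (Wc : root Epoly c) : is_Bpoly c (Bpoly Wc).
Proof. exact: xchooseP. Qed.

Hypotheses (p_odd : odd p) (ah_neq0 : a ord_max != 0).

Lemma Epoly_neq0 : Epoly != 0.
Proof.
apply: contraNneq ah_neq0 => /(congr1 (fun f : {poly k} => f`_(p ^ (h + h)))).
have p_gt1 := prime_gt1 p_pr.
have expp_inj i j : (p ^ i == p ^ j)%N = (i == j) by rewrite eqn_exp2l.
rewrite coef0 coefD /Rpoly exp_sum ?pcharP // !coef_sum big_ord_recr /=.
rewrite big1 ?add0r => [|i _]; last first.
  rewrite exprZn -exprM -expnD coefZ coefXn expp_inj eqn_add2r.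
  by rewrite gtn_eqF ?mulr0 //= ltn_ord.
rewrite exprZn -exprM -expnD coefZ coefXn eqxx mulr1.
have [h0|h_gt0] := posnP h; last first.
  rewrite big1 ?addr0 => [/eqP|i _]; first by rewrite expf_eq0 => /andP[].
  rewrite exprZn coefZ coefXn expp_inj gtn_eqF ?mulr0 //.
  by rewrite (leq_ltn_trans (leq_subr _ _)) // -[X in (X < _)%N]addn0 ltn_add2l.
rewrite big_ord_recr /= big1 ?add0r => [|i _]; last first.
  by have:= ltn_ord i; rewrite [X in (_ < X)%N]h0.
have ph1: (p ^ h = 1)%N by rewrite h0.
rewrite subnn expn0 expr1 coefZ coefX expnD ph1 expr1 mulr1 -mulr2n => /eqP.
rewrite -mulr_natl mulf_eq0 => /orP[] // /eqP k2.
have: 2%N \in [pchar k] by rewrite inE /= k2 eqxx.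
by rewrite (pcharf_eq pchark) inE /= => /eqP p2; move: p_odd; rewrite -p2.
Qed.

End CharP.

(* The type of the elements of the group P: sigma_(b, c) is represented by
   u = (b, c), which it determines (aut_act_inj). The group law is composition
   (aut_actMg). The premises are those needed for P to be a finite group. *)
Definition autP of prime p & odd p & {rmorphism 'F_p -> k} & a ord_max != 0 :
  predArgType := {u : k * k | aut_pair u}.

Section AutP.

Hypotheses (p_pr : prime p) (p_odd : odd p) (iota : {rmorphism 'F_p -> k}).
Hypothesis ah_neq0 : a ord_max != 0.

Let pchark : p \in [pchar k] := rmorph_pchar iota (pchar_Fp p_pr).

Local Notation P := (autP p_pr p_odd iota ah_neq0).

HB.instance Definition _ := SubChoice.copy P {u : k * k | aut_pair u}.

Definition aut_b (u : P) : k := (val u).1.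
Definition aut_c (u : P) : k := (val u).2.

Lemma aut_cP (u : P) : root Epoly (aut_c u).
Proof. by have /andP[] := valP u. Qed.

Lemma aut_bP (u : P) :
  aut_b u ^+ p - aut_b u = aut_c u * Rpoly.[aut_c u].
Proof. by have /andP[_ /eqP] := valP u. Qed.

Definition aut_B (u : P) : {poly k} := Bpoly p_pr iota (aut_cP u).

(* The action of sigma_(b, c) on C_R(k). *)
Definition aut_act (u : P) (Q : option (k * k)) : option (k * k) :=
  if Q is Some (x, y) then
    Some (x + aut_c u, y + aut_b u + (aut_B u).[x])
  else None.

Lemma aut_act_curve u Q : on_curve Q -> on_curve (aut_act u Q).
Proof.
case: Q => [[x y]|] //= /eqP Exy; apply/eqP.
have /andP[_ /eqP/(congr1 (horner^~ x))] := BpolyP p_pr iota (aut_cP u).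
rewrite !hornerE -/(aut_B u) => EB.
have:= expD p_pr (y + aut_b u) (aut_B u).[x] 1 pchark.
have:= expD p_pr y (aut_b u) 1 pchark; rewrite !expn1 => -> ->.
rewrite (RpolyD p_pr iota).
transitivity ((y ^+ p - y) + (aut_b u ^+ p - aut_b u)
              + ((aut_B u).[x] ^+ p - (aut_B u).[x])); first by ring.
by rewrite Exy aut_bP EB; ring.
Qed.

Lemma aut_act_inj u v :
  (forall Q, on_curve Q -> aut_act u Q = aut_act v Q) -> u = v.
Proof.
have B0 w : (aut_B w).[0] = 0.
  by have /andP[/eqP] := BpolyP p_pr iota (aut_cP w); rewrite horner_coef0.
move/(_ (Some (0, 0))) => /=.
rewrite mul0r expr0n gtn_eqF ?prime_gt0 // subrr eqxx => /(_ isT)[].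
rewrite !add0r !B0 !addr0 => Ec Eb; apply: val_inj.
by rewrite [LHS]surjective_pairing [RHS]surjective_pairing; congr (_, _).
Qed.

Lemma aut_pair1 : aut_pair (0, 0).
Proof.
rewrite /aut_pair /= rootE (Epoly0 p_pr iota) eqxx /= mul0r expr0n.
by rewrite gtn_eqF ?prime_gt0 // subrr.
Qed.

Definition aut_one : P := Sub (0, 0) aut_pair1.

(* The image of (0, 0) under sigma_u \o sigma_v determines sigma_u \o sigma_v;
   see aut_actM below. *)
Definition aut_mulval (u v : P) : k * k :=
  (aut_b v + aut_b u + (aut_B u).[aut_c v], aut_c v + aut_c u).

Lemma aut_pairM u v : aut_pair (aut_mulval u v).
Proof.
rewrite /aut_pair /= rootE (EpolyD p_pr iota).
rewrite (eqP (aut_cP u)) (eqP (aut_cP v)) addr0 eqxx /=.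
have:= @aut_act_curve u (Some (aut_c v, aut_b v)).
by rewrite /= aut_bP eqxx => /(_ isT).
Qed.

Definition aut_mul (u v : P) : P := Sub (aut_mulval u v) (aut_pairM u v).

Lemma aut_actM u v Q : aut_act (aut_mul u v) Q = aut_act u (aut_act v Q).
Proof.
case: Q => [[x y]|] //=; rewrite {1}/aut_c {1}/aut_b /= addrA.
have ->: aut_B (aut_mul u v) = aut_B v + aut_B u.
  apply: (is_Bpoly_inj p_pr iota (BpolyP p_pr iota (aut_cP (aut_mul u v)))).
  by apply: (is_BpolyD p_pr iota); apply: BpolyP.
rewrite (hornerBD p_pr iota _ _ (BpolyP p_pr iota (aut_cP u))) hornerD.
by congr (Some (_, _)); rewrite -/(aut_B u); ring.
Qed.

Lemma aut_act1 Q : aut_act aut_one Q = Q.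
Proof.
case: Q => [[x y]|] //=; rewrite /aut_c /aut_b /= !addr0.
suffices ->: aut_B aut_one = 0 by rewrite horner0 addr0.
apply: (is_Bpoly_inj p_pr iota (BpolyP p_pr iota (aut_cP aut_one))).
rewrite /is_Bpoly coef0 eqxx expr0n gtn_eqF ?prime_gt0 //= subr0.
by rewrite /aut_c /= (Rpoly0 p_pr iota) !scale0r addr0.
Qed.

Lemma aut_pairV u : aut_pair (- aut_b u + (aut_B u).[aut_c u], - aut_c u).
Proof.
have /andP[_ /eqP/(congr1 (horner^~ (aut_c u)))] := BpolyP p_pr iota (aut_cP u).
rewrite !hornerE -/(aut_B u) => EB.
rewrite /aut_pair /= rootE (EpolyN p_pr iota) (eqP (aut_cP u)) oppr0 eqxx /=.
rewrite (RpolyN p_pr iota) mulrNN [- aut_b u + _]addrC.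
have:= expB p_pr (aut_B u).[aut_c u] (aut_b u) 1 pchark; rewrite expn1 => ->.
apply/eqP; transitivity (((aut_B u).[aut_c u] ^+ p - (aut_B u).[aut_c u])
   - (aut_b u ^+ p - aut_b u)); first by ring.
by rewrite EB aut_bP; ring.
Qed.

Definition aut_inv (u : P) : P := Sub _ (aut_pairV u).

Lemma aut_mulA : associative aut_mul.
Proof. by move=> u v w; apply: aut_act_inj => Q _; rewrite !aut_actM. Qed.

Lemma aut_mul1 : left_id aut_one aut_mul.
Proof. by move=> u; apply: aut_act_inj => Q _; rewrite aut_actM aut_act1. Qed.

Lemma aut_mulV : left_inverse aut_one aut_inv aut_mul.
Proof.
move=> u; apply: val_inj; rewrite /= /aut_mulval {2}/aut_c {1}/aut_b /=.
congr (_, _); last by rewrite /aut_c /= subrr.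
have EB := hornerBD p_pr iota (aut_c u) (- aut_c u).
have ->: (aut_B (aut_inv u)).[aut_c u] = - (aut_B u).[aut_c u].
  apply/eqP; rewrite -addr_eq0 -hornerD.
  suffices ->: aut_B (aut_inv u) + aut_B u = 0 by rewrite horner0.
  have BD := is_BpolyD p_pr iota (BpolyP p_pr iota (aut_cP (aut_inv u)))
                (BpolyP p_pr iota (aut_cP u)).
  apply: (is_Bpoly_inj p_pr iota BD).
  rewrite /is_Bpoly coef0 eqxx expr0n gtn_eqF ?prime_gt0 //= subr0.
  by rewrite {1 2}/aut_c /= addNr (Rpoly0 p_pr iota) !scale0r addr0.
by rewrite /aut_b /=; ring.
Qed.

Definition aut_enum : seq P :=
  pmap insub [seq (b, c) | c <- zeros Epoly,
                           b <- zeros ('X^p - 'X - (c * Rpoly.[c])%:P)].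

Lemma mem_aut_enum u : u \in aut_enum.
Proof.
rewrite mem_pmap_sub [val u]surjective_pairing; apply/allpairsPdep.
exists (aut_c u), (aut_b u); split=> //.
  by rewrite mem_zeros ?Epoly_neq0 // aut_cP.
rewrite mem_zeros ?rootE ?hornerE ?aut_bP ?subrr // -size_poly_gt0.
rewrite -addrA size_polyDl ?size_polyXn // -opprD size_polyN.
by rewrite size_XaddC ltnS prime_gt1.
Qed.

Lemma aut_enumP : Finite.axiom (undup aut_enum).
Proof.
apply: Finite.uniq_enumP; first exact: undup_uniq.
by move=> u; rewrite mem_undup mem_aut_enum.
Qed.

Lemma aut_pickleK :
  pcancel (fun u => index u aut_enum) (fun i => onth aut_enum i).
Proof.
move=> u; have Pu := mem_aut_enum u.
by rewrite /= onthE (nth_map u) ?index_mem // nth_index.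
Qed.

HB.instance Definition _ := isCountable.Build P aut_pickleK.
HB.instance Definition _ := isFinite.Build P aut_enumP.
HB.instance Definition _ := Finite_isGroup.Build P aut_mulA aut_mul1 aut_mulV.

Lemma aut_actMg (u v : P) Q : aut_act (u * v)%g Q = aut_act u (aut_act v Q).
Proof. exact: aut_actM. Qed.

(* The elements of the image of A under P -> W. *)
Definition aut_image (A : {set P}) : seq k := undup [seq aut_c u | u in A].

Definition aut_const (A : {set P}) : k :=
  if h == 0%N then a ord_max
  else a ord_max / 2 * \prod_(c <- aut_image A | c != 0) c.

End AutP.

End Curve.

(* Main.v *)
(* The y-coordinate is eliminated by Artin-Schreier theory: over F_q, q = p^m,
   the curve has 1 + p #{x | Tr (x R(x)) = 0} points.  A maximal abelian
   subgroup A of P maps onto a Lagrangian subspace V (of order p^h) of W for the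
   commutator pairing c, c' |-> B_c(c') - B_c'(c).  With f = \prod_(c in V) (X - c),
   one has x R(x) = kappa / 2 f(x)^2 + G(x)^p - G(x) with
   kappa \prod_(c in V, c != 0) c = a_h, so that kappa / 2 and a_A are in the same
   square class.  Since f(W) is isotropic in F_q for the form
   Tr (kappa / 2 z^2), with orthogonal f(F_q), counting the zeros of this form
   on F_q or on f(F_q) amounts to the same.  The form itself is treated without
   characters: the numbers of zeros of Tr (a z^2) for a in the two square classes
   have sum 2 q / p; the classes are exchanged by F_p^* when m is odd, and when
   m = 2 j the form vanishes on F_(p^j) if a^(p^j) = - a.  The L-polynomial then
   follows from the numbers of points, by a differential equation which
   determines L. *)
Require Import Defs.
From mathcomp Require Import all_boot all_order all_algebra all_fingroup all_field.
From mathcomp Require Import ring zify.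

Set Implicit Arguments.
Unset Strict Implicit.
Unset Printing Implicit Defensive.

Import GRing.Theory Num.Theory.
Local Open Scope ring_scope.

(** * Finite subgroups of an abelian group *)

(** The identity for x R(x) comes from its polar form x R(y) + y R(x). For x = c in V this is
    B_c(y)^p - B_c(y). Isotropy of V says exactly that B_c(c') is symmetric on V, so that it extends
    to a symmetric biadditive polynomial b(x, y) on k, of degree less than p^h in each variable.
    Then x R(y) + y R(x) - (b(x, y)^p - b(x, y)) has degree at most p^h in each variable and
    vanishes as soon as one of them lies in V; since V has the full order p^h, this form is kappa
    f(x) f(y). Putting x = y and halving gives the identity, with G(x) = b(x, x) / 2. No quotient
    curve is constructed. As k is infinite, its finite subgroups are duplicate-free lists, and
    orthogonality is handled by cardinals: an inclusion that is easy to see becomes an equality once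
    both sides have the same size. *)

Definition subgroup_seq (V : zmodType) (s : seq V) :=
  [/\ uniq s, 0 \in s & {in s &, forall x y, x - y \in s}].

Section SubgroupSeq.

Variables (V : zmodType) (s : seq V).
Hypothesis s_grp : subgroup_seq s.

Lemma subgroup_seqN x : x \in s -> - x \in s.
Proof. by case: s_grp => _ s0 sB sx; rewrite -sub0r sB. Qed.

Lemma subgroup_seqD x y : x \in s -> y \in s -> x + y \in s.
Proof.
by case: s_grp => _ _ sB sx sy; rewrite -[y]opprK sB ?subgroup_seqN.
Qed.

Lemma subgroup_seqMn x n : x \in s -> x *+ n \in s.
Proof.
case: s_grp => _ s0 _ sx; elim: n => // n IHn.
by rewrite mulrS subgroup_seqD.
Qed.

Lemma count_shift (P : pred V) y :
  y \in s -> count (fun x => P (x + y)) s = count P s.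
Proof.
case: s_grp => s_uniq _ sB sy.
rewrite -(count_map (fun x => x + y) P); apply/seq.permP/uniq_perm => //.
  by rewrite map_inj_uniq //; apply: addIr.
move=> x; apply/mapP/idP => [[z sz ->]|sx]; first exact: subgroup_seqD.
by exists (x - y); rewrite ?sB ?subrK.
Qed.

Section Image.

Variables (V' : zmodType) (f : V -> V').
Hypothesis fD : {morph f : x y / x + y}.

Lemma morphD0 : f 0 = 0.
Proof. by apply: (addrI (f 0)); rewrite -fD !addr0. Qed.

Lemma morphDN x : f (- x) = - f x.
Proof. by apply: (addrI (f x)); rewrite -fD !subrr morphD0. Qed.

Lemma morphDMn x n : f (x *+ n) = f x *+ n.
Proof. by elim: n => [|n IHn]; rewrite ?morphD0 // !mulrS fD IHn. Qed.

Lemma count_fibre x :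
  x \in s -> count (fun z => f z == f x) s = count (fun z => f z == 0) s.
Proof.
move=> sx; rewrite -(count_shift (fun z => f z == f x) sx).
by apply: eq_count => z; rewrite /= fD -{2}[f x]add0r (inj_eq (addIr _)).
Qed.

Lemma size_morphD_image :
  (size (undup (map f s)) * count (fun z => f z == 0%R) s = size s)%N.
Proof.
have [s_uniq _ _] := s_grp.
rewrite -{3}[s]filter_predT size_filter.
pose t := undup (map f s).
have -> : count predT s = (\sum_(y <- t) count (fun z => f z == y) s)%N.
  under eq_bigr do rewrite -sum1_count big_mkcond.
  rewrite exchange_big -sum1_count big_seq [RHS]big_seq; apply: eq_bigr => z sz.
  rewrite -big_mkcond sum1_count (@eq_count _ _ (pred1 (f z))) => [|y] /=.
    by rewrite count_uniq_mem ?undup_uniq // mem_undup map_f.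
  by rewrite eq_sym.
rewrite big_seq (eq_bigr (fun=> count (fun z => f z == 0) s)) => [|y].
  by rewrite -big_seq big_const_seq count_predT iter_addn_0 mulnC.
by rewrite mem_undup => /mapP[x sx ->]; apply: count_fibre.
Qed.

Lemma subgroup_image : subgroup_seq (undup (map f s)).
Proof.
have [_ s0 sB] := s_grp.
split=> [||x y]; rewrite ?undup_uniq ?mem_undup //.
  by rewrite -morphD0 map_f.
move=> /mapP[x' sx ->] /mapP[y' sy ->].
by rewrite -morphDN -fD map_f ?sB.
Qed.

End Image.

End SubgroupSeq.

(** * Additive maps to F_p and counts of orthogonal elements *)

Section PrimeField.

Variables (p : nat) (k : idomainType).
Hypotheses (p_pr : prime p) (pchark : p \in [pchar k]).

Lemma size_AS : size ('X^p - 'X : {poly k}) = p.+1.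
Proof.
by rewrite size_polyDl size_polyXn // size_polyN size_polyX ltnS prime_gt1.
Qed.

Lemma roots_AS (t : k) (s : seq k) :
  t ^+ p = t -> uniq s -> (forall x, x \in s -> x ^+ p = x) ->
  (p <= size s)%N -> t \in s.
Proof.
move=> tp s_uniq sp; apply: contraTT => s't; rewrite -ltnNge.
have pP : ('X^p - 'X : {poly k}) != 0 by rewrite -size_poly_gt0 size_AS.
have := @max_poly_roots _ _ (t :: s) pP; rewrite size_AS /= !ltnS s't; apply=> //.
rewrite rootE !hornerE tp subrr eqxx /=; apply/allP => x /sp xp.
by rewrite rootE !hornerE xp subrr.
Qed.

Lemma natr_inj_pchar m n :
  (m < p)%N -> (n < p)%N -> m%:R = n%:R :> k -> m = n.
Proof.
wlog le_mn : m n / (m <= n)%N => [IH lm ln E|_ ltn /esym/eqP].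
  by have [/IH|/ltnW/IH] := leqP m n; [apply|move=> /(_ ln lm (esym E))].
rewrite -subr_eq0 -natrB // -(dvdn_pcharf pchark).
have [|lt_mn] := posnP (n - m); first by lia.
by move/(dvdn_leq lt_mn); lia.
Qed.

(** The values of [f] at the multiples of [x] are p distinct roots of X^p - X, hence all of F_p. So
    [f] is onto F_p, and its fibres are cosets of the kernel. *)
Lemma count_Fp (V : zmodType) (s : seq V) (f : V -> k) x t :
  subgroup_seq s -> {morph f : x y / x + y} ->
  (forall y, y \in s -> f y ^+ p = f y) -> x \in s -> f x != 0 ->
  t ^+ p = t -> (p * count (fun z => f z == t) s = size s)%N.
Proof.
move=> s_grp fD fp sx fx0 tp; have [s_uniq s0 _] := s_grp.
pose T := [seq f (x *+ n) | n <- iota 0 p].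
have T_uniq : uniq T.
  rewrite map_inj_in_uniq ?iota_uniq // => m n; rewrite !mem_iota /= => lm ln.
  rewrite !morphDMn // -[f x *+ m]mulr_natl -[f x *+ n]mulr_natl.
  by move/(mulIf fx0)/natr_inj_pchar; apply.
have Tp y : y \in T -> y ^+ p = y.
  by case/mapP=> n _ ->; rewrite fp ?subgroup_seqMn.
have sizeT : size T = p by rewrite size_map size_iota.
have imT : undup (map f s) =i T.
  move=> y; rewrite mem_undup; apply/mapP/mapP => [[z sz ->]|[n _ ->]].
    by apply/mapP/roots_AS; rewrite ?sizeT ?fp.
  by exists (x *+ n); rewrite ?subgroup_seqMn.
have : t \in T by apply: roots_AS; rewrite ?sizeT.
rewrite -imT mem_undup => /mapP[y sy ->]; rewrite count_fibre //.
rewrite -(size_morphD_image s_grp fD) -{1}sizeT.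
by congr (_ * _)%N; apply/esym/perm_size/uniq_perm; rewrite ?undup_uniq.
Qed.

(* The duality |U^perp| |U| = |Z| results from counting twice the pairs
   (z, u) such that b z u = 0. *)
Lemma size_perp (V : zmodType) (s u : seq V) (b : V -> V -> k) :
  subgroup_seq s -> subgroup_seq u ->
  (forall y, {morph b^~ y : x x' / x + x'}) -> (forall x, {morph b x : y y' / y + y'}) ->
  (forall x y, x \in s -> y \in u -> b x y ^+ p = b x y) ->
  (forall y, y \in u -> y != 0 -> exists2 x, x \in s & b x y != 0) ->
  (count (fun x => all (fun y => b x y == 0%R) u) s * size u = size s)%N.
Proof.
move=> s_grp u_grp bDl bDr bp b_nd; set P := (fun x => _).
have p_gt1 := prime_gt1 p_pr.
have zp : (0 : k) ^+ p = 0 by rewrite expr0n gtn_eqF // ltnW.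
have [s_uniq s0 _] := s_grp; have [u_uniq u0 _] := u_grp.
(* The pairs sorted by y: for y = 0 every x qualifies, for any other y one x in p does. In [El] they
   are sorted by x, with U^perp in the place of 0. *)
have Er : (p * \sum_(y <- u) count (fun x => b x y == 0%R) s
            = (size u).-1 * size s + p * size s)%N.
  rewrite (perm_big _ (perm_to_rem u0)) big_cons /= mulnDr addnC big_distrr /=.
  congr (_ + _)%N; last first.
    congr (_ * _)%N; apply/eqP; rewrite -all_count.
    by apply/allP => x _; rewrite morphD0.
  rewrite -(size_rem u0) big_seq (eq_bigr (fun=> size s)) => [|y].
    by rewrite -big_seq big_const_seq count_predT iter_addn_0 mulnC.
  rewrite mem_rem_uniq // inE => /andP[y0 uy]; have [x sx bxy] := b_nd y uy y0.
  by apply: (count_Fp s_grp _ _ sx) => // z sz; apply: bp.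
have El : (p * \sum_(x <- s) count (fun y => b x y == 0%R) u
            = count P s * (p * size u) + count (predC P) s * size u)%N.
  rewrite big_distrr /= (bigID P) /=; congr (_ + _)%N.
    rewrite -sum1_count big_distrl /=; apply: eq_bigr => x Px.
    by rewrite mul1n; congr (_ * _)%N; apply/eqP; rewrite -all_count.
  rewrite -sum1_count big_distrl /= big_seq_cond [RHS]big_seq_cond.
  apply: eq_bigr => x /andP[sx /allPn[y uy bxy]].
  by rewrite mul1n (count_Fp u_grp _ _ uy) // => z uz; apply: bp.
have : (\sum_(y <- u) count (fun x => b x y == 0%R) s
          = \sum_(x <- s) count (fun y => b x y == 0%R) u)%N.
  under eq_bigr do rewrite -sum1_count big_mkcond.
  under [RHS]eq_bigr do rewrite -sum1_count big_mkcond.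
  exact: exchange_big.
move/(congr1 (muln p)); rewrite Er El.
have := count_predC P s.
have u_gt0 : (0 < size u)%N by rewrite -has_predT; apply/hasP; exists 0.
move: (count P s) (count (predC P) s) (size u) (size s) u_gt0 => a c u' s' u_gt0.
move=> E1; rewrite -E1 => E2.
have : ((p - 1) * (a * u') = (p - 1) * (a + c))%N by nia.
by move/eqP; rewrite eqn_pmul2l ?subn_gt0 // => /eqP.
Qed.

(* Outside of U^perp, the quadratic form Q is equidistributed on each coset of
   the isotropic subgroup U. *)
Lemma count_isotropic (V : zmodType) (s u : seq V) (Q : V -> k) (b : V -> V -> k)
    (P := fun x => all (fun y => b x y == 0) u) :
  subgroup_seq s -> subgroup_seq u -> {subset u <= s} ->
  (forall y, {morph b^~ y : x x' / x + x'}) -> (forall x, {morph b x : y y' / y + y'}) ->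
  (forall x y, x \in s -> y \in u -> b x y ^+ p = b x y) ->
  (forall x, x \in s -> Q x ^+ p = Q x) ->
  (forall x y, Q (x + y) = Q x + Q y + b x y) ->
  (forall y, y \in u -> Q y = 0) ->
  (p * count (fun x => Q x == 0%R) s + count P s =
   p * count (fun x => P x && (Q x == 0%R)) s + size s)%N.
Proof.
move=> s_grp u_grp us bDl bDr bp Qp QD Qu.
have [u_uniq u0 uB] := u_grp.
have u_gt0 : (0 < size u)%N by rewrite -has_predT; apply/hasP; exists 0.
(* Q vanishes at x, y and x + y, so [u] is orthogonal to itself. *)
have buu x y : x \in u -> y \in u -> b x y = 0.
  move=> ux uy; have := QD x y; rewrite !Qu ?subgroup_seqD //.
  by rewrite !add0r => <-.
have PD x y : y \in u -> P (x + y) = P x.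
  move=> uy; apply: eq_in_all => z uz.
  by rewrite (bDl z x y) (buu y z) // addr0.
(* Average over the translations by y in [u]: for x outside U^perp the map y |-> b(x, y) is onto
   F_p, so one y in p satisfies Q(x + y) = Q(x) + b(x, y) = 0. *)
have EC : (p * count (fun x => ~~ P x && (Q x == 0%R)) s = count (predC P) s)%N.
  apply/eqP; rewrite -(eqn_pmul2l u_gt0); apply/eqP.
  transitivity (\sum_(y <- u) p *
      count (fun x => ~~ P (x + y)%R && (Q (x + y)%R == 0%R)) s)%N.
    rewrite big_seq (eq_bigr (fun=> (p * count (fun x => ~~ P x && (Q x == 0%R)) s)%N)).
      by rewrite -big_seq big_const_seq count_predT iter_addn_0 mulnC.
    move=> y uy; congr (_ * _)%N.
    by rewrite (count_shift s_grp (fun x => ~~ P x && (Q x == 0)) (us y uy)).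
  transitivity (p * \sum_(x <- s | ~~ P x) count (fun y => b x y == - Q x) u)%N.
    rewrite -big_distrr /=; congr (_ * _)%N.
    under [RHS]eq_bigr do rewrite -sum1_count big_mkcond.
    rewrite exchange_big /= big_seq [RHS]big_seq; apply: eq_bigr => y uy.
    rewrite -sum1_count big_mkcond [RHS]big_mkcond; apply: eq_bigr => x _ /=.
    rewrite PD // QD (Qu y uy) addr0 addrC addr_eq0.
    by case: (P x).
  rewrite big_distrr /= -sum1_count big_distrr /= big_seq_cond [RHS]big_seq_cond.
  apply: eq_bigr => x /andP[sx /allPn[y uy bxy]]; rewrite muln1.
  apply: (count_Fp u_grp _ _ uy) => //; first by move=> z uz; apply: bp.
  have := expB p_pr 0 (Q x) 1 pchark; rewrite !sub0r expn1 => ->.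
  by rewrite expr0n gtn_eqF ?prime_gt0 // sub0r Qp.
have E1 := count_predC P s.
have E2 : (count (fun x => P x && (Q x == 0%R)) s
  + count (fun x => ~~ P x && (Q x == 0%R)) s = count (fun x => Q x == 0%R) s)%N.
  rewrite -[RHS](size_filter _ s) -(count_predC P) !count_filter.
  by congr (_ + _)%N; apply: eq_count => x.
by rewrite -E2 mulnDr EC -addnA [(count _ _ + _)%N]addnC E1.
Qed.

End PrimeField.

(** * Finite subfields of k *)

Lemma size_zeros (k : closedFieldType) (f : {poly k}) :
  coprimep f f^`() -> size (zeros f) = (size f).-1.
Proof.
rewrite /zeros; case: closed_field_poly_normal => r /= Df cop_f.
have sep_f : separable_poly f by rewrite unlock.
have f0 := separable_poly_neq0 sep_f.
have l0 : lead_coef f != 0 by rewrite lead_coef_eq0.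
rewrite [in RHS]Df size_scale // size_prod_XsubC /= undup_id //.
rewrite -separable_prod_XsubC unlock; move: cop_f.
by rewrite {1 2}Df derivZ coprimepZl // coprimepZr.
Qed.

Section FiniteFields.

Variables (p : nat) (k : closedFieldType).
Hypotheses (p_pr : prime p) (pchark : p \in [pchar k]).

Local Notation GF := (GF p k).
Let p_gt0 : (0 < p)%N := prime_gt0 p_pr.
Let p_gt1 : (1 < p)%N := prime_gt1 p_pr.

Lemma natrX_pchar m : (0 < m)%N -> (p ^ m)%:R = 0 :> k.
Proof. by case: m => // m _; rewrite expnS natrM (pcharf0 pchark) mul0r. Qed.

Lemma GF_expE m x : (0 < m)%N -> x \in GF m -> x ^+ (p ^ m) = x.
Proof. by move=> m_gt0; rewrite mem_GF // => /eqP. Qed.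

Lemma size_GF m : (0 < m)%N -> size (GF m) = (p ^ m)%N.
Proof.
move=> m_gt0; have pm_gt1 : (1 < p ^ m)%N by rewrite -(exp1n m) ltn_exp2r.
rewrite /Defs.GF size_zeros.
  by rewrite size_polyDl size_polyXn // size_polyN size_polyX ltnS.
rewrite derivB derivXn derivX -mulr_natl -polyC_natr.
rewrite natrX_pchar // polyC0 mul0r.
have -> : 0 - 1 = (-1) *: 1 :> {poly k} by rewrite scaleN1r sub0r.
by rewrite coprimepZr ?coprimep1 // oppr_eq0 oner_eq0.
Qed.

Lemma expN_pchar (x : k) i : (- x) ^+ (p ^ i) = - x ^+ (p ^ i).
Proof.
have := expB p_pr 0 x i pchark; rewrite !sub0r => ->.
by rewrite expr0n gtn_eqF ?expn_gt0 ?p_gt0 // sub0r.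
Qed.

Lemma GF_grp m : (0 < m)%N -> subgroup_seq (GF m).
Proof.
move=> m_gt0; split; first exact: zeros_uniq.
  by rewrite mem_GF // expr0n gtn_eqF ?expn_gt0 ?p_gt0.
move=> x y; rewrite !mem_GF // => /eqP Ex /eqP Ey.
by rewrite expB // Ex Ey.
Qed.

Section Closed.

Variable m : nat.
Hypothesis m_gt0 : (0 < m)%N.

Lemma GF0 : 0 \in GF m. Proof. by have [] := GF_grp m_gt0. Qed.

Lemma GFB x y : x \in GF m -> y \in GF m -> x - y \in GF m.
Proof. by have [_ _] := GF_grp m_gt0; apply. Qed.

Lemma GFD x y : x \in GF m -> y \in GF m -> x + y \in GF m.
Proof. exact: (subgroup_seqD (GF_grp m_gt0)). Qed.

Lemma GFN x : x \in GF m -> - x \in GF m.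
Proof. exact: (subgroup_seqN (GF_grp m_gt0)). Qed.

Lemma GFM x y : x \in GF m -> y \in GF m -> x * y \in GF m.
Proof. by rewrite !mem_GF // exprMn => /eqP-> /eqP->. Qed.

Lemma GFX x n : x \in GF m -> x ^+ n \in GF m.
Proof. by rewrite !mem_GF // exprAC => /eqP->. Qed.

Lemma GFV x : x \in GF m -> x^-1 \in GF m.
Proof. by rewrite !mem_GF // exprVn => /eqP->. Qed.

Lemma GF_nat n : n%:R \in GF m.
Proof.
by apply: (subgroup_seqMn (GF_grp m_gt0)); rewrite mem_GF // expr1n.
Qed.

Lemma GF_sum (I : Type) (r : seq I) (P : pred I) (F : I -> k) :
  (forall i, P i -> F i \in GF m) -> \sum_(i <- r | P i) F i \in GF m.
Proof.
by move=> FP; elim/big_ind: _ => //; [apply: GF0|move=> x y; apply: GFD].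
Qed.

Lemma GF_dvd n : (0 < n)%N -> (m %| n)%N -> {subset GF m <= GF n}.
Proof.
move=> n_gt0 /dvdnP[d Dn] x; rewrite !mem_GF // Dn mulnC => /eqP xm.
by elim: d {Dn} => [|d IHd]; rewrite ?muln0 // mulnS expnD exprM xm.
Qed.

End Closed.

Definition trace m (x : k) := \sum_(i < m) x ^+ (p ^ i).

Lemma traceD m : {morph trace m : x y / x + y}.
Proof.
by move=> x y; rewrite /trace -big_split; apply: eq_bigr => i _; rewrite /= expD.
Qed.

Lemma trace_frob m x : (0 < m)%N -> x \in GF m -> trace m (x ^+ p) = trace m x.
Proof.
case: m => // m m_gt0 Gx; rewrite /trace big_ord_recr big_ord_recl /= addrC.
rewrite -exprM -expnS GF_expE // expn0 expr1; congr (_ + _).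
by apply: eq_bigr => i _; rewrite -exprM -expnS.
Qed.

Lemma traceX m x : trace m x ^+ p = trace m (x ^+ p).
Proof.
have := exp_sum p_pr (index_enum 'I_m) (fun i => x ^+ (p ^ i)) 1 pchark.
by rewrite expn1 => ->; apply: eq_bigr => i _; rewrite exprAC.
Qed.

Lemma trace_Fp m x : (0 < m)%N -> x \in GF m -> trace m x ^+ p = trace m x.
Proof. by move=> m_gt0 Gx; rewrite traceX trace_frob. Qed.

Lemma trace_AS m x : (0 < m)%N -> x \in GF m -> trace m (x ^+ p - x) = 0.
Proof.
move=> m_gt0 Gx; have := traceD m (x ^+ p - x) x.
by rewrite subrK trace_frob // => E; apply: (addIr (trace m x)); rewrite -E add0r.
Qed.

(** The trace is a polynomial function of degree p^(m - 1), too small to vanish at all p^m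
    elements. *)
Lemma trace_neq0 m : (0 < m)%N -> exists2 x, x \in GF m & trace m x != 0.
Proof.
case: m => // m m_gt0; pose f : {poly k} := \sum_(i < m.+1) 'X^(p ^ i).
have size_f : size f = (p ^ m).+1.
  rewrite /f big_ord_recr /= addrC size_polyDl size_polyXn // ltnS.
  apply: leq_trans (size_sum _ _ _) _; apply/bigmax_leqP => i _.
  by rewrite size_polyXn ltn_exp2l.
apply/hasP; rewrite -[has _ _]negbK -all_predC; apply/allP => tr0.
have f0 : f != 0 by rewrite -size_poly_gt0 size_f.
suff : (p ^ m.+1 <= p ^ m)%N by rewrite leq_exp2l // ltnn.
rewrite -(size_GF m_gt0) -ltnS -size_f; apply: max_poly_roots f0 _ (zeros_uniq _).
apply/allP => x /tr0 /=; rewrite negbK => /eqP trx.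
rewrite rootE horner_sum -[X in _ == X]trx; apply/eqP/eq_bigr => i _.
by rewrite hornerXn.
Qed.

Lemma trace_nondeg m c : (0 < m)%N -> c \in GF m -> c != 0 ->
  exists2 x, x \in GF m & trace m (c * x) != 0.
Proof.
move=> m_gt0 Gc c0; have [x Gx trx] := trace_neq0 m_gt0.
by exists (c^-1 * x); rewrite ?mulVKf // GFM ?GFV.
Qed.

Lemma morph_AS : {morph (fun y : k => y ^+ p - y) : x y / x + y}.
Proof. by move=> x y /=; have := expD p_pr x y 1 pchark; rewrite expn1 => ->; ring. Qed.

(** Additive Hilbert 90 by counting: the image of y |-> y^p - y lies in the kernel of the trace, and
    both have p^(m - 1) elements. *)
Lemma count_AS m z : (0 < m)%N -> z \in GF m ->
  count (fun y => y ^+ p - y == z) (GF m) = (p * (trace m z == 0%R))%N.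
Proof.
move=> m_gt0 Gz; have G_grp := GF_grp m_gt0.
have ker_AS : count (fun y : k => y ^+ p - y == 0) (GF m) = p.
  transitivity (size (GF 1)); last by rewrite size_GF // expn1.
  rewrite -size_filter; apply/perm_size/uniq_perm.
  - by rewrite filter_uniq ?zeros_uniq.
  - exact: zeros_uniq.
  move=> x; rewrite mem_filter subr_eq0 [in RHS]mem_GF // expn1.
  apply: andb_idr => xp; apply: (@GF_dvd 1) => //.
  by rewrite mem_GF.
have im_AS := size_morphD_image G_grp morph_AS.
have [x Gx trx] := trace_neq0 m_gt0.
have zp : (0 : k) ^+ p = 0 by rewrite expr0n gtn_eqF.
have ker_tr := count_Fp p_pr pchark G_grp (@traceD m) (fun y => @trace_Fp m y m_gt0) Gx trx zp.
set I := undup _ in im_AS.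
have IT : I =i [seq x <- GF m | trace m x == 0].
  have [||//] := @uniq_min_size _ I [seq x <- GF m | trace m x == 0] (undup_uniq _).
    move=> y; rewrite mem_undup => /mapP[w Gw ->].
    by rewrite mem_filter trace_AS ?eqxx ?GFB ?GFX.
  rewrite size_filter -(leq_pmul2l p_gt0) ker_tr -im_AS ker_AS mulnC.
  exact: leqnn.
have [/mapP[y Gy ->]|Iz] := boolP (z \in map (fun y : k => y ^+ p - y) (GF m)).
  by rewrite (count_fibre G_grp morph_AS Gy) ker_AS trace_AS // eqxx muln1.
have := IT z; rewrite mem_filter Gz andbT mem_undup (negPf Iz) => <-.
rewrite muln0; apply/eqP; rewrite -leqn0 leqNgt -has_count; apply: contra Iz.
by case/hasP=> y Gy /eqP <-; apply: map_f.
Qed.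

Lemma size_curve_points h (a : 'I_h.+1 -> k) m : (0 < m)%N ->
  (forall i, a i \in GF m) ->
  size (curve_points p a m)
    = (p * count (fun x => trace m (x * (Rpoly p a).[x]) == 0%R) (GF m)).+1.
Proof.
move=> m_gt0 Ga; rewrite /curve_points /= size_filter /=; congr _.+1.
have GR x : x \in GF m -> x * (Rpoly p a).[x] \in GF m.
  move=> Gx; rewrite GFM // /Rpoly horner_sum GF_sum // => i _.
  by rewrite hornerZ hornerXn GFM ?GFX.
rewrite -sum1_count big_mkcond big_allpairs_dep /= -sum1_count big_distrr /=.
rewrite [RHS]big_mkcond big_seq [RHS]big_seq; apply: eq_bigr => x Gx.
rewrite -big_mkcond sum1_count.
transitivity (count (fun y => y ^+ p - y == x * (Rpoly p a).[x]) (GF m)) => //.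
rewrite count_AS ?GR //.
by case: eqP => _; rewrite ?muln1 ?muln0.
Qed.

End FiniteFields.

(** * Quadratic forms Tr (a z^2) *)

Lemma exists_nth_root (k : closedFieldType) n (x : k) :
  (0 < n)%N -> exists t, t ^+ n = x.
Proof.
move=> n_gt0; have [|t] := closed_rootP ('X^n - x%:P) _.
  by rewrite size_XnsubC // eqSS -lt0n.
by rewrite rootE !hornerE subr_eq0 => /eqP; exists t.
Qed.

Lemma count_comp (T : eqType) (s : seq T) (g : T -> T) (P : pred T) :
  uniq s -> {in s, forall x, g x \in s} ->
  count (fun x => P (g x)) s = (\sum_(y <- s | P y) count (fun x => g x == y) s)%N.
Proof.
move=> s_uniq gs; under [RHS]eq_bigr do rewrite -sum1_count big_mkcond.
rewrite exchange_big -sum1_count big_mkcond big_seq [RHS]big_seq /=.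
apply: eq_bigr => x sx; rewrite -big_mkcondr sum1_count.
rewrite -(@eq_count _ (fun y => P (g x) && (y == g x))) => [|y].
  have [_|_] := boolP (P (g x)); last by rewrite count_pred0.
  by rewrite (@eq_count _ _ (pred1 (g x))) // count_uniq_mem // gs.
by rewrite /= eq_sym; case: eqP => [->|]; rewrite ?andbF ?andbT.
Qed.

Section Quadratic.

Variables (p : nat) (k : closedFieldType).
Hypotheses (p_pr : prime p) (p_odd : odd p) (pchark : p \in [pchar k]).

Local Notation GF := (GF p k).
Let p_gt0 : (0 < p)%N := prime_gt0 p_pr.
Let p_gt1 : (1 < p)%N := prime_gt1 p_pr.

Lemma natr2_neq0 : 2 != 0 :> k.
Proof.
apply: contraL p_odd => /eqP k2.
have : 2%N \in [pchar k] by rewrite inE /= k2 eqxx.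
by rewrite (pcharf_eq pchark) inE => /eqP <-.
Qed.

Lemma eq_opp (x : k) : (x == - x) = (x == 0).
Proof. by rewrite -addr_eq0 -mulr2n -mulr_natl mulf_eq0 (negPf natr2_neq0). Qed.

Definition qcount m (a : k) := count (fun z => trace p m (a * z ^+ 2) == 0) (GF m).

(** The root t is taken in k, so that the nonsquares of F_(p^m), whose roots lie outside, are
    covered as well. *)
Lemma count_sqr m (t : k) : (0 < m)%N -> t ^+ 2 \in GF m ->
  count (fun z => z ^+ 2 == t ^+ 2) (GF m)
    = if t \in GF m then (t != 0%R).+1 else 0%N.
Proof.
move=> m_gt0 Gt2; have G_uniq := zeros_uniq ('X^(p ^ m) - 'X : {poly k}).
have /(_ (GF m))/esym := count_predUI (pred1 t) (pred1 (- t)).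
rewrite !count_uniq_mem // => E.
have -> : count (fun z => z ^+ 2 == t ^+ 2) (GF m)
    = count (predU (pred1 t) (pred1 (- t))) (GF m).
  by apply: eq_count => z /=; rewrite eqf_sqr.
have GN : (- t \in GF m) = (t \in GF m).
  apply/idP/idP => [Gt|]; last exact: GFN.
  by rewrite -[t]opprK GFN.
move: E; rewrite GN.
have -> : count (predI (pred1 t) (pred1 (- t))) (GF m)
    = ((t == 0%R) && (t \in GF m)) :> nat.
  have [->|t0] := eqVneq t 0.
    rewrite oppr0 (@eq_count _ _ (pred1 0)) ?count_uniq_mem // => z /=.
    by rewrite andbb.
  rewrite (@eq_count _ _ pred0) ?count_pred0 // => z /=.
  by have [->|] := eqVneq z t; rewrite // eq_opp (negPf t0).
by case: (t \in GF m); case: (t == 0) => /=; lia.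
Qed.

Lemma count_trace_mul m (a : k) : (0 < m)%N -> a \in GF m -> a != 0 ->
  (p * count (fun w => trace p m (a * w) == 0%R) (GF m) = p ^ m)%N.
Proof.
move=> m_gt0 Ga a0; rewrite -(size_GF p_pr pchark m_gt0).
have [x Gx trx] := trace_nondeg p_pr pchark m_gt0 Ga a0.
apply: (@count_Fp _ _ p_pr pchark _ _ (fun w => trace p m (a * w)) x) => //.
- exact: GF_grp.
- by move=> y z; rewrite mulrDr traceD.
- by move=> y Gy; apply: trace_Fp => //; apply: GFM.
by rewrite expr0n gtn_eqF.
Qed.

(** Here n^2 is a nonsquare of F_(p^m). The maps z |-> z^2 and z |-> n^2 z^2 together hit every
    element exactly twice: 0 once each, any other element twice by just one of them. The sum is thus
    twice the count for the linear form w |-> Tr (a w). *)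
Lemma qcount_nonsquare m (a n : k) : (0 < m)%N -> a \in GF m -> a != 0 ->
  n != 0 -> n ^+ (p ^ m) = - n ->
  (p * (qcount m a + qcount m (a * n ^+ 2)) = 2 * p ^ m)%N.
Proof.
move=> m_gt0 Ga a0 n0 nq; have G_uniq := zeros_uniq ('X^(p ^ m) - 'X : {poly k}).
have Gn2 : n ^+ 2 \in GF m by rewrite mem_GF // exprAC nq sqrrN.
have -> : qcount m (a * n ^+ 2)
    = count (fun z => trace p m (a * (n ^+ 2 * z ^+ 2)) == 0) (GF m).
  by apply: eq_count => z; rewrite (mulrA a (n ^+ 2)).
rewrite /qcount.
rewrite (@count_comp _ _ (fun z => z ^+ 2) (fun w => trace p m (a * w) == 0)) //; last first.
  by move=> x; apply: GFX.
rewrite (@count_comp _ _ (fun z => n ^+ 2 * z ^+ 2) (fun w => trace p m (a * w) == 0)) //; last first.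
  by move=> x Gx; rewrite GFM // GFX.
rewrite -big_split /= -(count_trace_mul m_gt0 Ga a0) mulnCA; congr (_ * _)%N.
rewrite -sum1_count big_distrr /= big_seq_cond [RHS]big_seq_cond.
apply: eq_bigr => w /andP[Gw _].
have [t Dw] := exists_nth_root w (isT : (0 < 2)%N); rewrite -{w}Dw in Gw *.
rewrite count_sqr //.
have -> : count (fun x => n ^+ 2 * x ^+ 2 == t ^+ 2) (GF m)
        = count (fun x => x ^+ 2 == (t / n) ^+ 2) (GF m).
  have n20 : n ^+ 2 != 0 by rewrite expf_neq0.
  apply: eq_count => x /=; rewrite expr_div_n; apply/eqP/eqP => [<-|->].
    by rewrite mulrC mulKf.
  by rewrite mulrC divfK.
have Gtn : (t / n) ^+ 2 \in GF m by rewrite expr_div_n GFM ?GFV.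
rewrite count_sqr // mulf_eq0 invr_eq0 (negPf n0) orbF.
have [->|t0] := eqVneq t 0; first by rewrite mul0r GF0.
(* Frobenius multiplies t by a sign and t / n by the opposite one: exactly one of the two lies in
   F_(p^m). *)
have : (t ^+ (p ^ m) == t) || (t ^+ (p ^ m) == - t).
  by rewrite -eqf_sqr exprAC (GF_expE p_pr m_gt0 Gw).
rewrite !mem_GF // expr_div_n nq invrN mulrN.
case/orP=> /eqP ->; rewrite ?mulNr ?opprK eqxx eq_sym.
  by rewrite eq_opp mulf_eq0 invr_eq0 (negPf n0) (negPf t0).
by rewrite eq_opp (negPf t0).
Qed.

Lemma qcount_sqr m (a w : k) : (0 < m)%N -> w \in GF m -> w != 0 ->
  qcount m (a * w ^+ 2) = qcount m a.
Proof.
move=> m_gt0 Gw w0; rewrite /qcount.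
have /seq.permP/(_ (fun z => trace p m (a * z ^+ 2) == 0)) <- :
    perm_eq [seq w * z | z <- GF m] (GF m).
  apply: uniq_perm; first by rewrite map_inj_uniq ?zeros_uniq //; apply: mulfI.
    exact: zeros_uniq.
  move=> x; apply/mapP/idP => [[z Gz ->]|Gx]; first by rewrite GFM.
  by exists (w^-1 * x); rewrite ?GFM ?GFV ?mulVKf.
by rewrite count_map; apply: eq_count => z /=; rewrite exprMn (mulrA a (w ^+ 2)).
Qed.

Lemma qcount_scalar m (a c : k) : c ^+ p = c -> c != 0 -> qcount m (a * c) = qcount m a.
Proof.
move=> cp c0; apply: eq_count => z /=.
suff -> : trace p m (a * c * z ^+ 2) = c * trace p m (a * z ^+ 2).
  by rewrite mulf_eq0 (negPf c0).
rewrite /trace big_distrr; apply: eq_bigr => i _ /=.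
have ci : c ^+ (p ^ i) = c.
  by case: i => i /= _; elim: i => [|i IHi]; rewrite ?expr1 // expnS exprM cp.
by rewrite mulrAC mulrC exprMn ci.
Qed.

(** If n^(p - 1) = -1, then n^2 is an element of F_p which remains a nonsquare in F_(p^m) for odd m.
    Scaling by n^2 exchanges the two square classes, but keeps the zeros since the trace is
    F_p-linear. *)
Lemma qcount_odd m (a : k) : odd m -> a \in GF m -> a != 0 -> (p * qcount m a = p ^ m)%N.
Proof.
move=> m_odd Ga a0; have m_gt0 : (0 < m)%N by case: (m) m_odd.
have [n Dn] := exists_nth_root (-1 : k) (ltn0Sn p.-2).
have n_p1 : n ^+ p.-1 = -1 by rewrite -Dn; congr (_ ^+ _); lia.
have np : n ^+ p = - n by rewrite -(prednK p_gt0) exprS n_p1 mulrN1.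
have n0 : n != 0.
  apply: contraNneq (oner_neq0 k) => n0; rewrite -oppr_eq0 -n_p1 n0 expr0n.
  by rewrite gtn_eqF // -subn1 subn_gt0.
have nq j : n ^+ (p ^ j) = (-1) ^+ j * n.
  elim: j => [|j IHj]; first by rewrite expr1 mul1r.
  by rewrite expnS exprM np (expN_pchar p_pr pchark) IHj exprS mulN1r mulNr.
have := qcount_nonsquare m_gt0 Ga a0 n0.
rewrite nq -signr_odd m_odd mulN1r => /(_ erefl).
rewrite qcount_scalar; first lia.
  by rewrite exprAC np sqrrN.
exact: expf_neq0.
Qed.

(* [a] is chosen so that the form [trace (a z ^ 2)] vanishes on F_(p^j), half
   of the space F_(p^(2j)). *)
Lemma qcount_hyperbolic m j (a : k) : (0 < j)%N -> m = j.*2 -> a != 0 ->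
  a ^+ (p ^ j) = - a -> (p * qcount m a = p ^ m + p.-1 * p ^ j)%N.
Proof.
move=> j_gt0 Dm a0 aq.
have m_gt0 : (0 < m)%N by rewrite Dm double_gt0.
have Ga : a \in GF m.
  by rewrite mem_GF // Dm -addnn expnD exprM aq (expN_pchar p_pr pchark) aq opprK.
have j_m : (j %| m)%N by rewrite Dm -muln2 dvdn_mulr.
have Gjm : {subset GF j <= GF m} := GF_dvd p_pr j_gt0 m_gt0 j_m.
(* The terms of index i and j + i of the trace cancel. *)
have tr0 (x : k) : x ^+ (p ^ j) = - x -> trace p m x = 0.
  move=> xq; rewrite /trace Dm -addnn big_split_ord /= -big_split /= big1 // => i _.
  by rewrite expnD exprM xq (expN_pchar p_pr pchark) addrN.
have tr0j (x y : k) : x \in GF j -> y \in GF j -> trace p m (a * (x * y)) = 0.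
  by move=> Gx Gy; apply: tr0; rewrite !exprMn aq !GF_expE // !mulNr.
pose b (x y : k) := trace p m (a * (2 * x * y)).
have G2 : 2 \in GF m by apply: GF_nat.
have b_nd (y : k) : y \in GF j -> y != 0 -> exists2 x, x \in GF m & b x y != 0.
  move=> Gy y0; have Gn : a * (2 * y) \in GF m by rewrite GFM // GFM // Gjm.
  have [|x Gx trx] := trace_nondeg p_pr pchark m_gt0 Gn.
    by rewrite !mulf_neq0 // natr2_neq0.
  by exists x; rewrite // /b [2 * x * y]mulrAC mulrA.
have bDl y : {morph b^~ y : x x' / x + x'}.
  by move=> x x'; rewrite /b mulrDr mulrDl mulrDr traceD.
have bDr x : {morph b x : y y' / y + y'}.
  by move=> y y'; rewrite /b mulrDr mulrDr traceD.
have bp x y : x \in GF m -> y \in GF j -> b x y ^+ p = b x y.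
  move=> Gx /Gjm Gy; apply: trace_Fp => //.
  by rewrite !GFM.
have Gm := GF_grp p_pr pchark m_gt0; have Gj := GF_grp p_pr pchark j_gt0.
have E1 := size_perp p_pr pchark Gm Gj bDl bDr bp b_nd.
have QD x y : trace p m (a * (x + y) ^+ 2) = trace p m (a * x ^+ 2)
    + trace p m (a * y ^+ 2) + b x y.
  by rewrite /b -!traceD //; congr (trace p m _); ring.
have Qp x : x \in GF m -> trace p m (a * x ^+ 2) ^+ p = trace p m (a * x ^+ 2).
  by move=> Gx; rewrite trace_Fp // GFM // GFX.
have Q0 y : y \in GF j -> trace p m (a * y ^+ 2) = 0 by move=> Gy; apply: tr0j.
have := count_isotropic p_pr pchark Gm Gj Gjm bDl bDr bp Qp QD Q0.
move: E1; rewrite -/(qcount m a) !size_GF //.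
set P := count _ (GF m); set P' := count _ (GF m) => E1.
have {}E1 : P = (p ^ j)%N.
  by apply/eqP; rewrite -(eqn_pmul2r (m := p ^ j)) ?expn_gt0 ?p_gt0 // E1 Dm -addnn expnD.
have -> : P' = P.
  (* F_(p^j) is contained in its orthogonal, and both have p^j elements. *)
  have perp_j : [seq x <- GF m | all (fun y => b x y == 0) (GF j)] =i GF j.
    have [||_ perp_j] := @uniq_min_size _ (GF j)
      [seq x <- GF m | all (fun y => b x y == 0) (GF j)] (zeros_uniq _).
    - move=> y Gy; rewrite mem_filter Gjm // andbT; apply/allP => z Gz.
      by rewrite /b tr0j // GFM // (GF_nat p_pr pchark).
    - by rewrite size_filter -/P E1 size_GF.
    by move=> x; rewrite perp_j.
  apply: eq_in_count => x Gx; apply: andb_idr => Px.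
  have : x \in GF j by rewrite -perp_j mem_filter Px.
  by move/Q0 ->.
rewrite E1; have := prednK p_gt0; lia.
Qed.

(** The bit b tells whether t^2 is a nonsquare in F_(p^m). The coefficient t^2 is compared with the
    coefficient u^2 of a hyperbolic form: in the same square class the counts agree, otherwise
    [qcount_nonsquare] applies. The parity of (p^j - 1) / 2 decides the class of u^2. *)
Lemma qcount_even m j (b : bool) (t : k) : (0 < j)%N -> m = j.*2 -> t != 0 ->
  t ^+ (p ^ m) = (-1) ^+ b * t ->
  if b (+) odd (p ^ j).-1./2 then (p * qcount m (t ^+ 2) = p ^ m + p.-1 * p ^ j)%N
  else (p * qcount m (t ^+ 2) + p.-1 * p ^ j = p ^ m)%N.
Proof.
move=> j_gt0 Dm t0 tq; have m_gt0 : (0 < m)%N by rewrite Dm double_gt0.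
have Gt2 : t ^+ 2 \in GF m by rewrite mem_GF // exprAC tq exprMn sqrr_sign mul1r.
pose q0 := (p ^ j)%N; have q0_gt1 : (1 < q0)%N by rewrite -(exp1n j) ltn_exp2r.
have q0_odd : odd q0 by rewrite oddX p_odd orbT.
have n_gt0 : (0 < 2 * q0.-1)%N by lia.
have [u Du] := exists_nth_root (-1 : k) n_gt0.
have u0 : u != 0.
  apply: contraNneq (oner_neq0 k) => u0; rewrite -oppr_eq0 -Du u0 expr0n.
  by rewrite gtn_eqF.
have u2q : (u ^+ 2) ^+ (p ^ j) = - u ^+ 2.
  by rewrite -/q0 -(prednK (ltnW q0_gt1)) exprS -exprM Du mulrN1.
(* The exponent q0^2 - 1 is the product of 2 (q0 - 1) and (q0 + 1) / 2, so u^(q0^2 - 1) = (-1)^((q0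
   + 1) / 2). *)
have uq : u ^+ (p ^ m) = (-1) ^+ (~~ odd q0.-1./2) * u.
  have -> : (p ^ m = (2 * q0.-1 * (q0.-1./2).+1).+1)%N.
    rewrite Dm -addnn expnD -/q0; set n := q0.-1./2.
    have -> : q0.-1 = n.*2 by rewrite halfK; lia.
    have -> : q0 = n.*2.+1 by rewrite halfK; lia.
    lia.
  by rewrite exprSr exprM Du -[(-1) ^+ _.+1]signr_odd.
have N1 := qcount_hyperbolic j_gt0 Dm (expf_neq0 2 u0) u2q.
have Gu2 : u ^+ 2 \in GF m by rewrite mem_GF // exprAC uq exprMn sqrr_sign mul1r.
have w0 : t / u != 0 by rewrite mulf_neq0 ?invr_eq0.
have Dt2 : t ^+ 2 = u ^+ 2 * (t / u) ^+ 2 by rewrite -exprMn mulrC divfK.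
have wq : (t / u) ^+ (p ^ m) = (-1) ^+ (b (+) ~~ odd q0.-1./2) * (t / u).
  by rewrite expr_div_n tq uq invfM signr_addb invr_sign; ring.
move: wq; rewrite addbN -/q0; case: (b (+) _) => /= wq.
  by rewrite Dt2 qcount_sqr // mem_GF // wq mul1r.
have := qcount_nonsquare m_gt0 Gu2 (expf_neq0 2 u0) w0.
rewrite -Dt2 wq mulN1r => /(_ erefl); rewrite mulnDr N1 -/q0; lia.
Qed.

End Quadratic.

(** * The commutator pairing *)

Lemma big_ord_pred (V : nmodType) n (F : nat -> V) : (0 < n)%N ->
  \sum_(i < n) F i = \sum_(i < n.-1) F i + F n.-1.
Proof. by case: n => // n _; rewrite big_ord_recr. Qed.

Section Commutator.

Variables (p : nat) (k : closedFieldType) (h : nat) (a : 'I_h.+1 -> k).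
Hypotheses (p_pr : prime p) (p_odd : odd p) (iota : {rmorphism 'F_p -> k}).
Hypothesis ah_neq0 : a ord_max != 0.

Let pchark : p \in [pchar k] := rmorph_pchar iota (pchar_Fp p_pr).
Let p_gt0 : (0 < p)%N := prime_gt0 p_pr.
Let p_gt1 : (1 < p)%N := prime_gt1 p_pr.

Local Notation R := (Rpoly p a).
Local Notation E := (Epoly p a).
Local Notation W := (zeros E).
Local Notation coefa i := (a (inord i)).

(* The coefficient of X^(p^n) in B_c, as a polynomial in c. *)
Fixpoint Bcoef n : {poly k} :=
  if n is m.+1 then Bcoef m ^+ p - coefa m.+1 *: 'X
  else - (coefa 0 *: 'X + R).

Lemma Bcoef0E c : (Bcoef 0).[c] = - (coefa 0 * c + R.[c]).
Proof. by rewrite /= !hornerE. Qed.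

Lemma BcoefSE n c :
  (Bcoef n.+1).[c] = (Bcoef n).[c] ^+ p - coefa n.+1 * c.
Proof. by rewrite /= !hornerE. Qed.

Lemma Bcoef_closed n c : (Bcoef n).[c]
  = - (R.[c] ^+ (p ^ n) + \sum_(i < n.+1) (coefa i * c) ^+ (p ^ (n - i))).
Proof.
elim: n => [|n IHn].
  by rewrite Bcoef0E expr1 big_ord1 expr1 addrC.
rewrite BcoefSE IHn -[p in X in X - _]expn1 expN_pchar // expD // exp_sum //.
rewrite -exprM -expnD addn1 [in RHS]big_ord_recr /= subnn expr1.
rewrite [in RHS]addrA [in RHS]opprD; congr (- (_ + _) - _).
by apply: eq_bigr => i _; rewrite -exprM -expnD addn1 subSn // -ltnS.
Qed.

Lemma BcoefD n x y : (Bcoef n).[x + y] = (Bcoef n).[x] + (Bcoef n).[y].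
Proof.
elim: n => [|n IHn]; first by rewrite !Bcoef0E (RpolyD _ p_pr iota); ring.
rewrite !BcoefSE IHn; have := expD p_pr (Bcoef n).[x] (Bcoef n).[y] 1 pchark.
by rewrite expn1 => ->; ring.
Qed.

(** The recursion for the coefficients of B_c must stop after h terms; the obstruction is this
    value, whose closed form is - E(c). *)
Lemma root_Bcoef c : root E c -> (Bcoef h).[c] = 0.
Proof.
move=> /eqP Ec; rewrite Bcoef_closed; apply/eqP.
rewrite oppr_eq0 -[X in _ == X]Ec EpolyE; apply/eqP; congr (_ + _).
by apply: eq_bigr => i _; rewrite inord_val.
Qed.

(** Equal to B_c(x) for c in W, but defined and additive for every c in k, so that degrees in c make
    sense. *)
Definition Bform (c x : k) := \sum_(i < h) (Bcoef i).[c] * x ^+ (p ^ i).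

Lemma BformDl x : {morph Bform^~ x : c c' / c + c'}.
Proof.
move=> c c'; rewrite /Bform -big_split; apply: eq_bigr => i _ /=.
by rewrite BcoefD mulrDl.
Qed.

Lemma BformDr c : {morph Bform c : x x' / x + x'}.
Proof.
move=> x x'; rewrite /Bform -big_split; apply: eq_bigr => i _ /=.
by rewrite expD // mulrDr.
Qed.

Lemma is_Bpoly_Bcoef c : root E c ->
  is_Bpoly p a c (\sum_(i < h) (Bcoef i).[c] *: 'X^(p ^ i)).
Proof.
move=> Ec; pose S n : {poly k} := \sum_(i < n) (Bcoef i).[c] *: 'X^(p ^ i).
have SP n : S n ^+ p - S n = c *: \sum_(i < n.+1) coefa i *: 'X^(p ^ i)
   + R.[c] *: 'X + (Bcoef n).[c] *: 'X^(p ^ n).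
  elim: n => [|n IHn].
    rewrite /S big_ord0 expr0n gtn_eqF // subr0 big_ord1.
    by rewrite Bcoef0E expn0 expr1 -!mul_polyC polyCN polyCD polyCM mulr0n /=; ring.
  rewrite /S big_ord_recr /= -/(S n) (asD p_pr iota) IHn.
  rewrite [in RHS]big_ord_recr BcoefSE exprZn -exprM -expnSr.
  by rewrite scalerDr scalerBl scalerA [coefa _ * c]mulrC; ring.
rewrite /is_Bpoly -/(S h) SP root_Bcoef // scale0r addr0; apply/andP; split.
  rewrite /S coef_sum big1 // => i _.
  by rewrite coefZ coefXn ltn_eqF ?mulr0 // expn_gt0 p_gt0.
apply/eqP; congr (c *: _ + _).
by apply: eq_bigr => i _; rewrite inord_val.
Qed.

Lemma Bform_horner c (Wc : root E c) x : (Bpoly p_pr iota Wc).[x] = Bform c x.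
Proof.
rewrite (is_Bpoly_inj p_pr iota (BpolyP p_pr iota Wc) (is_Bpoly_Bcoef Wc)).
by rewrite horner_sum; apply: eq_bigr => i _; rewrite hornerZ hornerXn.
Qed.

Lemma BformP c x : root E c -> Bform c x ^+ p - Bform c x = c * R.[x] + R.[c] * x.
Proof.
move=> Wc; have /andP[_ /eqP/(congr1 (horner^~ x))] := BpolyP p_pr iota Wc.
by rewrite !hornerE !Bform_horner.
Qed.

Lemma mem_W c : (c \in W) = root E c.
Proof. by rewrite mem_zeros // (Epoly_neq0 p_pr iota). Qed.

Lemma W_grp : subgroup_seq W.
Proof.
split=> [||x y]; first exact: zeros_uniq.
  by rewrite mem_W rootE (Epoly0 _ p_pr iota).
rewrite !mem_W => /eqP Ex /eqP Ey.
by rewrite rootE (EpolyD _ p_pr iota) (EpolyN _ p_pr iota) Ex Ey subr0.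
Qed.

Definition eps (c c' : k) := Bform c c' - Bform c' c.

Lemma epsDl c' : {morph eps^~ c' : x y / x + y}.
Proof. by move=> x y; rewrite /eps BformDl BformDr; ring. Qed.

Lemma epsDr c : {morph eps c : x y / x + y}.
Proof. by move=> x y; rewrite /eps BformDl BformDr; ring. Qed.

(** B_c(c') and B_c'(c) have the same image under y |-> y^p - y, because c R(c') + R(c) c' is
    symmetric. *)
Lemma eps_Fp c c' : root E c -> root E c' -> eps c c' ^+ p = eps c c'.
Proof.
move=> Wc Wc'; have := expB p_pr (Bform c c') (Bform c' c) 1 pchark.
rewrite expn1 => ->; apply/eqP; rewrite -subr_eq0 /eps; apply/eqP.
transitivity ((Bform c c' ^+ p - Bform c c') - (Bform c' c ^+ p - Bform c' c)).
  by ring.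
by rewrite !BformP //; ring.
Qed.

Hypothesis h_gt0 : (0 < h)%N.

Lemma size_Rpoly : size R = (p ^ h).+1.
Proof.
rewrite /Rpoly big_ord_recr /= addrC size_polyDl size_scale // size_polyXn //.
rewrite ltnS; apply: leq_trans (size_sum _ _ _) _; apply/bigmax_leqP => i _.
apply: leq_trans (size_scale_leq _ _) _.
by rewrite size_polyXn ltn_exp2l //= ltn_ord.
Qed.

Lemma size_Bcoef n : size (Bcoef n) = (p ^ (h + n)).+1.
Proof.
have lt1 m : (1 < p ^ (h + m))%N by rewrite -(exp1n (h + m)) ltn_exp2r // addn_gt0 h_gt0.
elim: n => [|n IHn] /=.
  rewrite size_polyN addrC size_polyDl size_Rpoly ?addn0 // ltnS.
  by apply: leq_trans (size_scale_leq _ _) _; rewrite size_polyX -(addn0 h).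
have f0 : Bcoef n != 0 by rewrite -size_poly_gt0 IHn.
have Ef : size (Bcoef n ^+ p) = (p ^ (h + n.+1)).+1.
  rewrite -[LHS]prednK ?size_poly_gt0 ?expf_neq0 // size_exp IHn /=.
  by rewrite addnS expnSr.
rewrite size_polyDl Ef // size_polyN ltnS.
by apply: leq_trans (size_scale_leq _ _) _; rewrite size_polyX.
Qed.

Lemma deriv_expp (f : {poly k}) n : (0 < n)%N -> (f ^+ (p ^ n))^`() = 0.
Proof.
move=> n_gt0; rewrite deriv_exp -mulr_natr -polyC_natr (natrX_pchar pchark n_gt0).
by rewrite polyC0 mulr0.
Qed.

(** Only the term i = h of E is not a p-th power, so E' is the nonzero constant a_h and E is
    separable. *)
Lemma size_W : size W = (p ^ (h + h))%N.
Proof.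
have dE : E^`() = (a ord_max)%:P.
  rewrite derivD deriv_expp // add0r raddf_sum big_ord_recr /= big1 => [|i _].
    by rewrite subnn expr1 derivZ derivX add0r -mul_polyC mulr1.
  by rewrite deriv_expp // subn_gt0 ltn_ord.
rewrite size_zeros; last by rewrite dE -[_%:P]mulr1 mul_polyC coprimepZr ?coprimep1.
rewrite size_polyDl.
  by rewrite size_exp size_Rpoly /= -expnD.
rewrite -[ltnRHS]prednK ?size_poly_gt0 ?expf_neq0 -?size_poly_gt0 ?size_Rpoly //.
rewrite size_exp size_Rpoly /= -expnD ltnS.
apply: leq_trans (size_sum _ _ _) _; apply/bigmax_leqP => i _.
rewrite exprZn; apply: leq_trans (size_scale_leq _ _) _.
rewrite size_polyXn ltn_exp2l //; lia.
Qed.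

(** For fixed c, eps(x, c) is a polynomial in x of degree p^(2h - 1), whose top term comes from the
    last coefficient of B_x, with the factor c^(p^(h - 1)). It cannot vanish on all p^(2h) elements
    of W. *)
Lemma eps_nondeg c : c \in W -> c != 0 -> exists2 c', c' \in W & eps c' c != 0.
Proof.
rewrite mem_W => Wc c0; apply/hasP; rewrite -[has _ _]negbK -all_predC.
apply/allP => eps0.
pose D1 : {poly k} := \sum_(i < h.-1) c ^+ (p ^ i) *: Bcoef i
    - \sum_(i < h) (Bcoef i).[c] *: 'X^(p ^ i).
pose D := D1 + c ^+ (p ^ h.-1) *: Bcoef h.-1.
have size_top : size (c ^+ (p ^ h.-1) *: Bcoef h.-1) = (p ^ (h + h.-1)).+1.
  by rewrite size_scale ?expf_neq0 // size_Bcoef.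
have size_D : size D = (p ^ (h + h.-1)).+1.
  rewrite /D addrC size_polyDl size_top // ltnS.
  apply: leq_trans (size_polyD _ _) _; rewrite size_polyN geq_max; apply/andP; split.
    apply: leq_trans (size_sum _ _ _) _; apply/bigmax_leqP => i _.
    apply: leq_trans (size_scale_leq _ _) _.
    by rewrite size_Bcoef ltn_exp2l // ltn_add2l.
  apply: leq_trans (size_sum _ _ _) _; apply/bigmax_leqP => i _.
  apply: leq_trans (size_scale_leq _ _) _.
  rewrite size_polyXn ltn_exp2l //; have := ltn_ord i; lia.
have D0 : D != 0 by rewrite -size_poly_gt0 size_D.
suff : (size W < size D)%N.
  rewrite size_W size_D ltnS leq_exp2l //; lia.
apply: max_poly_roots D0 _ (zeros_uniq _); apply/allP => x Wx.
have := eps0 x Wx; rewrite /= negbK => /eqP Ex.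
rewrite rootE -Ex /D /D1 !hornerE !horner_sum /eps {1}/Bform; apply/eqP.
rewrite (big_ord_pred (fun i => (Bcoef i).[x] * c ^+ (p ^ i)) h_gt0).
rewrite addrAC; congr (_ + _ - _).
- by apply: eq_bigr => i _; rewrite hornerZ mulrC.
- by rewrite mulrC.
by apply: eq_bigr => i _; rewrite hornerZ hornerXn.
Qed.

(** The hypotheses make V its own orthogonal in W, so that [size_perp] reads |V|^2 = p^(2h). *)
Lemma size_Lagrangian (V : seq k) :
  subgroup_seq V -> {subset V <= W} -> {in V &, forall x y, eps x y = 0} ->
  (forall x, x \in W -> (forall y, y \in V -> eps x y = 0) -> x \in V) ->
  size V = (p ^ h)%N.
Proof.
move=> V_grp VW V_iso V_max; have [V_uniq _ _] := V_grp.
have eps_p x y : x \in W -> y \in V -> eps x y ^+ p = eps x y.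
  by move=> Wx /VW Wy; apply: eps_Fp; rewrite -mem_W.
have eps_nd y : y \in V -> y != 0 -> exists2 x, x \in W & eps x y != 0.
  by move/VW; apply: eps_nondeg.
have := size_perp p_pr pchark W_grp V_grp epsDl epsDr eps_p eps_nd.
rewrite size_W -size_filter (_ : size _ = size V).
  by rewrite expnD => /eqP; rewrite !mulnn eqn_exp2r // => /eqP.
apply/perm_size/uniq_perm; rewrite ?filter_uniq ?zeros_uniq // => x.
rewrite mem_filter; apply/andP/idP => [[/allP Vx Wx]|Vx].
  by apply: V_max => // y Vy; apply/eqP/Vx.
by split; [apply/allP => y Vy; rewrite V_iso|apply: VW].
Qed.

End Commutator.

(** * Additive polynomials *)

Section AdditivePolynomials.

Variables (p : nat) (k : closedFieldType).
Hypotheses (p_pr : prime p) (pchark : p \in [pchar k]).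

Let p_gt0 : (0 < p)%N := prime_gt0 p_pr.
Let p_gt1 : (1 < p)%N := prime_gt1 p_pr.

Lemma poly_ext (f g : {poly k}) : (forall x, f.[x] = g.[x]) -> f = g.
Proof.
move=> fg; apply/eqP; rewrite -subr_eq0; apply/negPn/negP => fg0.
pose n := (size (f - g)).+1.
have : (size (GF p k n) < size (f - g)%R)%N.
  apply: max_poly_roots fg0 _ (zeros_uniq _).
  by apply/allP => x _; rewrite rootE !hornerE fg subrr.
rewrite (size_GF p_pr pchark) // ltnNge => /negP; apply.
by apply: ltnW (ltn_trans _ (ltn_expl n p_gt1)).
Qed.

(** In characteristic p this is the coefficient of X^(p^t) in (1 + X^(p^t))^u, namely u. *)
Lemma bin_neq0_pchar t u : ~~ (p %| u)%N -> 'C(p ^ t * u, p ^ t)%:R != 0 :> k.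
Proof.
move=> p'u; have pcharP : p \in [pchar {poly k}].
  exact: (rmorph_pchar (polyC : {rmorphism k -> {poly k}}) pchark).
have E n m : (((1 + 'X) ^+ n : {poly k})`_m = 'C(n, m)%:R).
  rewrite exprDn coef_sum; have [lt_mn|lt_nm] := leqP m n.
    rewrite (bigD1 (Ordinal (lt_mn : m < n.+1)%N)) //= big1 => [|i im].
      by rewrite addr0 expr1n mul1r coefMn coefXn eqxx.
    rewrite expr1n mul1r coefMn coefXn [m == _]eq_sym.
    by rewrite (negPf (im : val i != m)) mul0rn.
  rewrite bin_small // big1 // => i _.
  rewrite expr1n mul1r coefMn coefXn gtn_eqF ?mul0rn //.
  by rewrite (leq_ltn_trans _ lt_nm) // -ltnS.
rewrite -E exprM expD // expr1n exprDn coef_sum.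
have u_gt0 : (0 < u)%N by rewrite lt0n; apply: contraNneq p'u => ->.
rewrite (bigD1 (Ordinal (u_gt0 : 1 < u.+1)%N)) //= big1 => [|i i1].
  rewrite addr0 expr1n mul1r expr1 coefMn coefXn eqxx bin1.
  by rewrite -(dvdn_pcharf pchark).
rewrite expr1n mul1r -exprM coefMn coefXn -{1}[(p ^ t)%N]muln1.
by rewrite eqn_pmul2l ?expn_gt0 ?p_gt0 // [1%N == _]eq_sym (negPf (i1 : val i != 1%N)) mul0rn.
Qed.

(** By Taylor expansion, additivity makes every Hasse derivative of positive order constant. If n =
    p^t u with u > 1 prime to p, the derivative of order p^t has, in degree n - p^t > 0, the
    coefficient of X^n times a binomial coefficient prime to p. *)
Lemma additive_coef (f : {poly k}) n :
  {morph horner f : x y / x + y} -> f`_n != 0 -> exists i, n = (p ^ i)%N.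
Proof.
move=> fD fn; have f0 : f`_0 = 0 by rewrite -horner_coef0 (morphD0 fD).
have n_gt0 : (0 < n)%N by case: n fn => //; rewrite f0 eqxx.
have nderiv_const m : (0 < m)%N -> f^`N(m) = (f`_m)%:P.
  move=> m_gt0; apply: poly_ext => x; rewrite hornerC.
  have : \poly_(i < size f) f^`N(i).[x] = f + (f.[x])%:P.
    apply: poly_ext => y; rewrite horner_poly !hornerE addrC -fD.
    by rewrite nderiv_taylor //; apply: mulrC.
  move/(congr1 (fun g : {poly k} => g`_m)).
  rewrite coef_poly coefD coefC gtn_eqF // addr0; case: ltnP => // m_f <-.
  suff -> : f^`N(m) = 0 by rewrite horner0.
  apply/polyP => i; rewrite coef_nderivn coef0 nth_default ?mul0rn //.
  exact: leq_trans m_f (leq_addr _ _).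
have Dn : n = (p ^ logn p n * n`_p^')%N by rewrite -p_part partnC.
have p'u : ~~ (p %| n`_p^')%N.
  apply/negP => p_u; have := part_pnat p^' n.
  move/pnatP => /(_ (part_gt0 _ _) p p_pr p_u).
  by rewrite !inE eqxx.
move: Dn p'u; set t := logn p n; set u := (n`_p^')%N; move=> Dn p'u.
exists t; rewrite {1}Dn; have [->|u1] := eqVneq u 1%N; first by rewrite muln1.
have u_gt1 : (1 < u)%N by rewrite ltn_neqAle eq_sym u1 part_gt0.
have pt_gt0 : (0 < p ^ t)%N by rewrite expn_gt0 p_gt0.
have lt_n : (p ^ t < n)%N by rewrite Dn -{1}[(p ^ t)%N]muln1 ltn_pmul2l.
have /(congr1 (fun g : {poly k} => g`_(n - p ^ t)%N)) := nderiv_const _ pt_gt0.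
rewrite coef_nderivn subnKC ?(ltnW lt_n) // coefC gtn_eqF ?subn_gt0 //.
rewrite -mulr_natr => /eqP; rewrite mulf_eq0 (negPf fn) /= Dn.
by rewrite (negPf (bin_neq0_pchar _ p'u)).
Qed.

Lemma additive_polyE h (f : {poly k}) :
  {morph horner f : x y / x + y} -> (size f <= (p ^ h).+1)%N ->
  f = \sum_(i < h.+1) f`_(p ^ i) *: 'X^(p ^ i).
Proof.
move=> fD size_f; apply/polyP => n; rewrite coef_sum.
have [fn0|fn] := eqVneq f`_n 0.
  rewrite fn0 big1 // => i _; rewrite coefZ coefXn.
  by case: eqP => [<-|_]; rewrite ?mulr0 // fn0 mul0r.
have [t Dn] := additive_coef fD fn.
have t_h : (t < h.+1)%N.
  rewrite ltnS -(leq_exp2l _ _ p_gt1) -Dn -ltnS.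
  by apply: leq_trans size_f; rewrite ltnNge; apply: contra fn => /leq_sizeP->.
rewrite (bigD1 (Ordinal t_h)) //= -Dn coefZ coefXn eqxx mulr1 big1 ?addr0 // => i it.
by rewrite coefZ coefXn Dn eqn_exp2l // eq_sym (negPf (it : val i != t)) mulr0.
Qed.

Lemma coef_sum_ppow n (F : 'I_n -> k) (j : 'I_n) :
  (\sum_(i < n) F i *: 'X^(p ^ i) : {poly k})`_(p ^ j) = F j.
Proof.
rewrite coef_sum (bigD1 j) //= big1 => [|i ij].
  by rewrite coefZ coefXn eqxx mulr1 addr0.
by rewrite coefZ coefXn eqn_exp2l // eq_sym (negPf (ij : val i != j)) mulr0.
Qed.

(** * The monic polynomial vanishing on a finite subgroup of k *)

Section SubspacePolynomial.

Variables (h : nat) (V : seq k).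
Hypotheses (V_grp : subgroup_seq V) (size_V : size V = (p ^ h)%N).

Definition subspace_poly : {poly k} := \prod_(c <- V) ('X - c%:P).

Local Notation f := subspace_poly.

Lemma size_subspace_poly : size f = (p ^ h).+1.
Proof. by rewrite size_prod_XsubC size_V. Qed.

Lemma subspace_poly_monic : f`_(p ^ h) = 1.
Proof.
have /eqP : f \is monic by apply: monic_prod_XsubC.
by rewrite /lead_coef size_subspace_poly.
Qed.

Lemma subspace_poly_GF m x :
  (0 < m)%N -> {subset V <= GF p k m} -> x \in GF p k m -> f.[x] \in GF p k m.
Proof.
move=> m_gt0 VG Gx; rewrite horner_prod big_seq; elim/big_ind: _ => [|y z|c Vc].
- exact: (GF_nat p_pr pchark m_gt0 1).
- exact: GFM.
- by rewrite !hornerE GFB ?(VG c Vc).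
Qed.

Lemma root_subspace_poly c : root f c = (c \in V).
Proof. exact: root_prod_XsubC. Qed.

Lemma subspace_poly_roots (g : {poly k}) :
  (size g <= p ^ h)%N -> (forall c, c \in V -> g.[c] = 0) -> g = 0.
Proof.
move=> size_g gV; apply/eqP/negPn/negP => g0; have [V_uniq _ _] := V_grp.
have : (size V < size g)%N.
  apply: max_poly_roots g0 _ V_uniq; apply/allP => c /gV.
  by rewrite rootE => ->.
by rewrite size_V ltnNge size_g.
Qed.

(** f(X + y) - f(X) - f(y) has degree below p^h, as f(X + y) and f(X) are both monic of degree p^h,
    and it vanishes on V because f is invariant under translations by V. *)
Lemma subspace_polyD : {morph horner f : x y / x + y}.
Proof.
have fV x c : c \in V -> f.[x + c] = f.[x].
  move=> Vc; rewrite !horner_prod.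
  have VN := subgroup_seqN V_grp Vc.
  have [V_uniq _ _] := V_grp.
  rewrite -(perm_big _ (_ : perm_eq [seq d + c | d <- V] V)) /=.
    rewrite big_map; apply: eq_bigr => d _; rewrite !hornerE; ring.
  apply: uniq_perm; rewrite ?map_inj_uniq //; first exact: addIr.
  move=> x'; apply/mapP/idP => [[d Vd ->]|Vx]; first by rewrite subgroup_seqD.
  by exists (x' - c); rewrite ?subgroup_seqD ?subrK.
move=> x y; apply/eqP; rewrite -subr_eq0 opprD addrA; apply/eqP.
pose g := f \Po ('X + y%:P) - f - (f.[y])%:P.
suff : g = 0 by move/(congr1 (horner^~ x)); rewrite !hornerE horner_comp !hornerE.
apply: subspace_poly_roots => [|c Vc]; last first.
  rewrite !hornerE horner_comp !hornerE addrC [c + y]addrC fV //.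
  have /eqP -> : root f c by rewrite root_subspace_poly.
  by ring.
have Dfy : f \Po ('X + y%:P) = \prod_(d <- [seq c - y | c <- V]) ('X - d%:P).
  rewrite big_map rmorph_prod; apply: eq_bigr => c _ /=.
  by rewrite rmorphB /= comp_polyX comp_polyC polyCB; ring.
have size_fy : size (f \Po ('X + y%:P)) = (p ^ h).+1.
  by rewrite Dfy size_prod_XsubC size_map size_V.
have lead_fy : (f \Po ('X + y%:P))`_(p ^ h) = 1.
  have /eqP : f \Po ('X + y%:P) \is monic by rewrite Dfy; apply: monic_prod_XsubC.
  by rewrite /lead_coef size_fy.
apply/leq_sizeP => j le_j; rewrite !coefB coefC gtn_eqF; last first.
  by apply: leq_trans le_j; rewrite expn_gt0 p_gt0.
move: le_j; rewrite leq_eqVlt => /orP[/eqP <-|lt_j].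
  by rewrite lead_fy subspace_poly_monic !subrr.
by rewrite !nth_default ?size_fy ?size_subspace_poly // !subr0.
Qed.

Lemma subspace_polyE : f = \sum_(i < h.+1) f`_(p ^ i) *: 'X^(p ^ i).
Proof. by apply: additive_polyE subspace_polyD _; rewrite size_subspace_poly. Qed.

Hypothesis p_odd : odd p.

Lemma deriv_subspace_poly : f^`().[0] = \prod_(c <- V | c != 0) c.
Proof.
have [V_uniq V0 _] := V_grp.
rewrite /subspace_poly (perm_big _ (perm_to_rem V0)) big_cons /= subr0.
rewrite derivM derivX !hornerE horner_prod /=.
have -> : \prod_(c <- V | c != 0) c = \prod_(c <- rem 0 V) c.
  by rewrite rem_filter // big_filter; apply: eq_bigl => c; rewrite inE.
transitivity (\prod_(c <- rem 0 V) - c).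
  by apply: eq_bigr => c _; rewrite !hornerE.
under eq_bigr do rewrite -mulN1r.
(* The sign is (-1)^(p^h - 1) = 1, as p is odd. *)
rewrite big_split /= big_const_seq count_predT iter_mulr_1 -signr_odd.
rewrite size_rem // size_V (_ : odd _ = false) ?mul1r //.
have : odd (p ^ h) by rewrite oddX p_odd orbT.
by case: (p ^ h)%N => //= n /negPf.
Qed.

Lemma subspace_independent (l : 'I_h -> k) :
  (forall c, c \in V -> \sum_(j < h) l j * c ^+ (p ^ j) = 0) -> forall j, l j = 0.
Proof.
move=> lV j; have : \sum_(j < h) l j *: 'X^(p ^ j) = 0 :> {poly k}.
  apply: subspace_poly_roots => [|c Vc]; last first.
    by rewrite horner_sum -[RHS](lV c) //; apply: eq_bigr => i _; rewrite !hornerE.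
  apply: leq_trans (size_sum _ _ _) _; apply/bigmax_leqP => i _.
  apply: leq_trans (size_scale_leq _ _) _.
  by rewrite size_polyXn ltn_exp2l //= ltn_ord.
move/(congr1 (fun g : {poly k} => g`_(p ^ j))); by rewrite coef0 coef_sum_ppow.
Qed.

(** Reduction of additive polynomials modulo f: by [subspace_independent] the coefficients [l] are
    unique. *)
Definition representable (g : k -> k) :=
  exists l : 'I_h -> k, forall c, c \in V -> g c = \sum_(j < h) l j * c ^+ (p ^ j).

Lemma eq_representable g g' : g =1 g' -> representable g -> representable g'.
Proof. by move=> gg' [l lP]; exists l => c Vc; rewrite -gg' lP. Qed.

Lemma representableD g g' : representable g -> representable g' ->
  representable (fun c => g c + g' c).
Proof.
move=> [l lP] [l' lP']; exists (fun j => l j + l' j) => c Vc.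
by rewrite lP // lP' // -big_split; apply: eq_bigr => j _; rewrite /= mulrDl.
Qed.

Lemma representableZ x g : representable g -> representable (fun c => x * g c).
Proof.
move=> [l lP]; exists (fun j => x * l j) => c Vc.
by rewrite lP // big_distrr; apply: eq_bigr => j _; rewrite /= mulrA.
Qed.

Lemma representable_sum n (F : 'I_n -> k -> k) :
  (forall i, representable (F i)) -> representable (fun c => \sum_(i < n) F i c).
Proof.
elim: n F => [|n IHn] F FP.
  by exists (fun=> 0) => c _; rewrite big_ord0 big1 // => j _; rewrite mul0r.
have := representableD (IHn _ (fun i => FP (widen_ord (leqnSn n) i))) (FP ord_max).
by apply: eq_representable => c; rewrite big_ord_recr.
Qed.

(** Only i = h needs reduction: f vanishes on V, is monic of degree p^h, and its other terms are
    multiples of X^(p^j) with j < h. *)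
Lemma representable_monomial i : (i <= h)%N -> representable (fun c => c ^+ (p ^ i)).
Proof.
rewrite leq_eqVlt => /orP[/eqP ->|lt_i]; last first.
  exists (fun j => (val j == i)%:R) => c _; rewrite (bigD1 (Ordinal lt_i)) //= eqxx.
  by rewrite mul1r big1 ?addr0 // => j /negPf ji; rewrite [_ == i]ji mul0r.
exists (fun j => - f`_(p ^ j)) => c Vc; apply/eqP; rewrite -subr_eq0; apply/eqP.
have /eqP : root f c by rewrite root_subspace_poly.
rewrite {1}subspace_polyE horner_sum big_ord_recr /= subspace_poly_monic.
rewrite !hornerE => Ec; rewrite -[RHS]Ec addrC; congr (_ + _).
by rewrite -sumrN; apply: eq_bigr => j _; rewrite !hornerE mulNr opprK.
Qed.

Lemma representable_frob g : representable g -> representable (fun c => g c ^+ p).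
Proof.
move=> [l lP]; pose F (j : 'I_h) c := l j ^+ p * c ^+ (p ^ j.+1).
have [l' lP'] : representable (fun c => \sum_(j < h) F j c).
  by apply: representable_sum => j; apply/representableZ/representable_monomial.
exists l' => c Vc; rewrite -lP' // lP //.
have := exp_sum p_pr (index_enum 'I_h) (fun j => l j * c ^+ (p ^ j)) 1 pchark.
by rewrite expn1 => ->; apply: eq_bigr => j _; rewrite exprMn -exprM -expnSr.
Qed.

End SubspacePolynomial.

End AdditivePolynomials.

(** * The quotient by a Lagrangian subspace *)

Section Quotient.

Variables (p : nat) (k : closedFieldType) (h : nat) (a : 'I_h.+1 -> k).
Hypotheses (p_pr : prime p) (p_odd : odd p) (iota : {rmorphism 'F_p -> k}).
Hypotheses (ah_neq0 : a ord_max != 0) (h_gt0 : (0 < h)%N).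

Let pchark : p \in [pchar k] := rmorph_pchar iota (pchar_Fp p_pr).
Let p_gt0 : (0 < p)%N := prime_gt0 p_pr.
Let p_gt1 : (1 < p)%N := prime_gt1 p_pr.

Local Notation R := (Rpoly p a).
Local Notation W := (zeros (Epoly p a)).
Local Notation Bcoef := (Bcoef p a).
Local Notation Bform := (Bform p a).
Local Notation GF := (GF p k).

Variable V : seq k.
Hypotheses (V_grp : subgroup_seq V) (VW : {subset V <= W}).
Hypotheses (V_iso : {in V &, forall x y, eps p a x y = 0}).
Hypothesis size_V : size V = (p ^ h)%N.

Local Notation f := (subspace_poly V).

Variable m : nat.
Hypotheses (m_gt0 : (0 < m)%N) (Ga : forall i, a i \in GF m).
Hypotheses (VG : {subset V <= GF m}) (h_m : (h < m)%N).

Lemma representable_Bcoef n : (n <= h)%N ->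
  representable p h V (fun c => (Bcoef n).[c]).
Proof.
have Rid : representable p h V id.
  have := representable_monomial p_pr pchark V_grp size_V (leq0n h).
  by apply: eq_representable => c; rewrite expr1.
elim: n => [_|n IHn le_n].
  have RR : representable p h V (fun c => R.[c]).
    apply: (eq_representable (g := fun c => \sum_(i < h.+1) a i * c ^+ (p ^ i))).
      by move=> c; rewrite RpolyE.
    apply: representable_sum => i; apply: representableZ.
    by apply: representable_monomial => //; rewrite -ltnS.
  have := representableZ (-1) (representableD (representableZ (a (inord 0)) Rid) RR).
  by apply: eq_representable => c; rewrite Bcoef0E mulN1r.
have := representableD (representable_frob p_pr pchark V_grp size_V (IHn (ltnW le_n)))
  (representableZ (- a (inord n.+1)) Rid).
by apply: eq_representable => c; rewrite BcoefSE mulNr.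
Qed.

Lemma Rpoly_GF x : x \in GF m -> R.[x] \in GF m.
Proof.
move=> Gx; rewrite RpolyE; apply: (GF_sum p_pr pchark m_gt0) => i _.
by rewrite GFM ?GFX.
Qed.

Lemma Bcoef_GF n c : c \in GF m -> (Bcoef n).[c] \in GF m.
Proof.
move=> Gc; elim: n => [|n IHn]; rewrite ?Bcoef0E ?BcoefSE.
  by rewrite GFN // GFD ?GFM ?Rpoly_GF.
by rewrite GFB ?GFX ?GFM.
Qed.

(* [x R(x)] is, modulo [G ^ p - G], the pullback by [f] of [kappa / 2 z ^ 2]:
   the right-hand side of the equation of the quotient curve C_R / V. *)
Lemma quotient_curve : exists kappa, exists G : k -> k,
  [/\ kappa \in GF m, kappa * \prod_(c <- V | c != 0) c = a ord_max,
      forall x, x \in GF m -> G x \in GF m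
    & forall x, x * R.[x] = kappa / 2 * f.[x] ^+ 2 + (G x ^+ p - G x)].
Proof.
have n2 : (2 : k) != 0 := natr2_neq0 p_odd pchark.
have [b bP] := fin_all_exists (fun i : 'I_h => representable_Bcoef (ltnW (ltn_ord i))).
have indep := subspace_independent p_pr V_grp size_V.
(* Raising the coefficients to the power p^m represents the same function on V, which takes its
   values in F_(p^m); uniqueness shows that they are fixed. *)
have b_GF i j : b i j \in GF m.
  rewrite mem_GF // -subr_eq0; apply/eqP.
  apply: (indep (fun j => b i j ^+ (p ^ m) - b i j)) => c Vc.
  under eq_bigr do rewrite mulrBl.
  rewrite big_split sumrN /= -bP // -(GF_expE p_pr m_gt0 (Bcoef_GF i (VG Vc))).
  apply/eqP; rewrite subr_eq0 bP // exp_sum //; apply/eqP/eq_bigr => l _.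
  by rewrite exprMn exprAC (GF_expE p_pr m_gt0 (VG Vc)).
(* The extension of [Bform] from first arguments in V to all of k. *)
pose bil x y := \sum_(i < h) \sum_(j < h) b i j * x ^+ (p ^ j) * y ^+ (p ^ i).
have bilV c y : c \in V -> bil c y = Bform c y.
  move=> Vc; rewrite /bil /Bform; apply: eq_bigr => i _.
  by rewrite bP // big_distrl.
(* Isotropy makes [bil] symmetric on V; independence of the monomials on V, used once in each
   argument, carries this over to the coefficients. *)
have b_sym i j : b i j = b j i.
  apply/eqP; rewrite -subr_eq0; apply/eqP.
  apply: (indep (fun j => b i j - b j i)) => c Vc.
  apply: (indep (fun i => \sum_(j < h) (b i j - b j i) * c ^+ (p ^ j))) => d Vd.
  have := V_iso Vc Vd; rewrite /eps -!bilV // => Ecd.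
  rewrite -[RHS]Ecd /bil [X in _ = _ - X]exchange_big /= -sumrB; apply: eq_bigr => i' _.
  by rewrite big_distrl /= -sumrB; apply: eq_bigr => j' _; ring.
have bilC x y : bil x y = bil y x.
  rewrite /bil exchange_big; apply: eq_bigr => i _; apply: eq_bigr => j _.
  by rewrite b_sym mulrAC.
pose bp y : {poly k} := \sum_(j < h) (\sum_(i < h) b i j * y ^+ (p ^ i)) *: 'X^(p ^ j).
have bpE x y : (bp y).[x] = bil x y.
  rewrite horner_sum /bil exchange_big; apply: eq_bigr => j _ /=.
  by rewrite !hornerE big_distrl; apply: eq_bigr => i _; rewrite /= mulrAC.
have size_bp y : (size (bp y) <= (p ^ h.-1).+1)%N.
  apply: leq_trans (size_sum _ _ _) _; apply/bigmax_leqP => j _.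
  apply: leq_trans (size_scale_leq _ _) _.
  rewrite size_polyXn ltnS leq_exp2l //; have := ltn_ord j; lia.
pose gp y := y *: R + R.[y] *: 'X - bp y ^+ p + bp y.
have gpE x y : (gp y).[x] = x * R.[y] + y * R.[x] - (bil x y ^+ p - bil x y).
  by rewrite /gp !hornerE bpE; ring.
have size_bpp y : (size (bp y ^+ p) <= (p ^ h).+1)%N.
  apply: leq_trans (size_poly_exp_leq _ _) _; rewrite ltnS.
  have -> : (p ^ h = p ^ h.-1 * p)%N by rewrite -expnSr prednK.
  rewrite leq_pmul2r //.
  by have := size_bp y; case: size.
have size_gp y : (size (gp y) <= (p ^ h).+1)%N.
  have ph_gt0 : (0 < p ^ h)%N by rewrite expn_gt0 p_gt0.
  have ph1 : (p ^ h.-1 <= p ^ h)%N by rewrite leq_exp2l ?leq_pred.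
  apply: leq_trans (size_polyD _ _) _; rewrite geq_max (leq_trans (size_bp y)) // andbT.
  apply: leq_trans (size_polyD _ _) _; rewrite geq_max size_polyN size_bpp andbT.
  apply: leq_trans (size_polyD _ _) _; rewrite geq_max; apply/andP; split.
    by apply: leq_trans (size_scale_leq _ _) _; rewrite size_Rpoly.
  by apply: leq_trans (size_scale_leq _ _) _; rewrite size_polyX.
(* A polynomial of degree at most p^h that vanishes on V is f times its coefficient in degree p^h.
   By symmetry, [lam] is in turn proportional to f. *)
pose lam y := (gp y)`_(p ^ h).
have gp_lam y : gp y = lam y *: f.
  apply/eqP; rewrite -subr_eq0; apply/eqP.
  apply: (subspace_poly_roots V_grp size_V) => [|c Vc].
    apply/leq_sizeP => j; rewrite coefB coefZ leq_eqVlt => /orP[/eqP <-|lt_j].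
      by rewrite subspace_poly_monic // mulr1 subrr.
    rewrite nth_default ?(leq_trans (size_gp y)) // nth_default ?mulr0 ?subrr //.
    by rewrite (size_subspace_poly size_V).
  have Wc : root (Epoly p a) c by rewrite -(mem_W p_pr p_odd iota ah_neq0) VW.
  have /eqP fc : root f c by rewrite root_subspace_poly.
  rewrite hornerD hornerN hornerZ gpE fc mulr0 subr0 bilV // (BformP p_pr iota) //; ring.
have gpC x y : (gp y).[x] = (gp x).[y] by rewrite !gpE (bilC x y); ring.
have lam_sym x y : lam y * f.[x] = lam x * f.[y].
  by have := gpC x y; rewrite !gp_lam !hornerZ.
(* Since h < m, the p^h zeros of f do not exhaust F_(p^m), so that [kappa] can be computed inside
   this field. *)
have [x0 Gx0 fx0] : exists2 x, x \in GF m & f.[x] != 0.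
  apply/hasP; rewrite -[has _ _]negbK -all_predC; apply/allP => f0.
  have : (size (GF m) <= size V)%N.
    apply: uniq_leq_size (zeros_uniq _) _ => x /f0.
    by rewrite /= negbK -rootE root_subspace_poly.
  by rewrite size_V (size_GF p_pr pchark) // leq_exp2l // leqNgt h_m.
pose kappa := lam x0 / f.[x0].
have lamE y : lam y = kappa * f.[y].
  by rewrite /kappa mulrAC -lam_sym mulfK.
pose G x := bil x x / 2.
have bil_GF x y : x \in GF m -> y \in GF m -> bil x y \in GF m.
  move=> Gx Gy; apply: GF_sum => // i _; apply: GF_sum => // j _.
  by rewrite !GFM ?GFX.
have f_GF x := @subspace_poly_GF p k p_pr pchark V m x m_gt0 VG.
(* In kappa f(x) f(y), take the coefficient of x and in it that of y^(p^h). The p-th power of [bil]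
   has no term linear in x and [bil] has degree below p^h in y, so only a_h from x R(y) is left. *)
have kappa_f1 : kappa * f`_1 = a ord_max.
  pose qp : {poly k} := \sum_(i < h) b i (Ordinal h_gt0) *: 'X^(p ^ i).
  have Ef : (kappa * f`_1) *: f = R`_1 *: 'X + R + qp.
    apply: (poly_ext p_pr pchark) => y; rewrite hornerZ mulrAC -lamE.
    have := congr1 (fun g : {poly k} => g`_1) (gp_lam y); rewrite coefZ => <-.
    rewrite /gp coefD coefB coefD !coefZ coefX mulr1.
    have -> : (bp y ^+ p)`_1 = 0.
      have := congr1 (fun g : {poly k} => g`_0) (deriv_expp p_pr iota (bp y) (ltn0Sn 0)).
      by rewrite coef_deriv coef0 expn1.
    have -> : (bp y)`_1 = qp.[y].
      rewrite (_ : 1%N = p ^ (Ordinal h_gt0))%N // (coef_sum_ppow p_pr).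
      by rewrite horner_sum; apply: eq_bigr => i _; rewrite !hornerE.
    by rewrite subr0 !hornerE [y * _]mulrC.
  have /(congr1 (fun g : {poly k} => g`_(p ^ h))) := Ef.
  rewrite coefZ subspace_poly_monic // mulr1 => ->.
  rewrite !coefD coefZ coefX gtn_eqF ?mulr0 ?add0r; last first.
    exact: leq_ltn_trans h_gt0 (ltn_expl h p_gt1).
  rewrite (coef_sum_ppow p_pr _ ord_max) nth_default ?addr0 //.
  apply: leq_trans (size_sum _ _ _) _; apply/bigmax_leqP => i _.
  apply: leq_trans (size_scale_leq _ _) _.
  by rewrite size_polyXn ltn_exp2l //= ltn_ord.
have G2 : 2 \in GF m by apply: GF_nat.
exists kappa, G; split.
- have Gb := bil_GF x0 x0 Gx0 Gx0; have GR := Rpoly_GF Gx0.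
  have Glam : lam x0 \in GF m.
    rewrite -[lam x0](mulfK fx0) -hornerZ -gp_lam gpE GFM ?GFV ?f_GF //.
    have Gxx := GFM p_pr m_gt0 Gx0 GR; apply: (GFB p_pr pchark m_gt0).
      exact: (GFD p_pr pchark m_gt0).
    by apply: (GFB p_pr pchark m_gt0) => //; apply: GFX.
  by rewrite GFM ?GFV ?f_GF.
- rewrite -kappa_f1 -(deriv_subspace_poly V_grp size_V p_odd).
  by rewrite horner_coef0 coef_deriv.
- by move=> x Gx; rewrite /G GFM ?GFV ?bil_GF.
move=> x; have := gpE x x; rewrite gp_lam hornerZ lamE => Ex.
(* 1 / 2 lies in F_p, so halving commutes with y |-> y^p - y. *)
have two_p : (2^-1 : k) ^+ p = 2^-1.
  by rewrite exprVn; congr (_^-1); have := pFrobenius_aut_nat pchark 2.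
apply: (mulfI n2); rewrite /G exprMn two_p.
transitivity (kappa * f.[x] * f.[x] + (bil x x ^+ p - bil x x)).
  by rewrite Ex; ring.
by field.
Qed.

End Quotient.

(** * Comparison of the zeros of Tr (x R(x)) and of Tr (kappa / 2 z^2) *)

Section PointCount.

Variables (p : nat) (k : closedFieldType) (h : nat) (a : 'I_h.+1 -> k).
Hypotheses (p_pr : prime p) (p_odd : odd p) (iota : {rmorphism 'F_p -> k}).
Hypotheses (ah_neq0 : a ord_max != 0) (h_gt0 : (0 < h)%N).

Let pchark : p \in [pchar k] := rmorph_pchar iota (pchar_Fp p_pr).
Let p_gt0 : (0 < p)%N := prime_gt0 p_pr.
Let p_gt1 : (1 < p)%N := prime_gt1 p_pr.

Local Notation R := (Rpoly p a).
Local Notation W := (zeros (Epoly p a)).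
Local Notation GF := (GF p k).

Variable V : seq k.
Hypotheses (V_grp : subgroup_seq V) (VW : {subset V <= W}).
Hypotheses (V_iso : {in V &, forall x y, eps p a x y = 0}).
Hypothesis size_V : size V = (p ^ h)%N.

Local Notation f := (subspace_poly V).

Variable m : nat.
Hypotheses (m_gt0 : (0 < m)%N) (Ga : forall i, a i \in GF m).
Hypothesis WG : {subset W <= GF m}.

Lemma trace_AS_form c x : c \in W -> x \in GF m -> trace p m (c * R.[x] + R.[c] * x) = 0.
Proof.
move=> Wc Gx; have Gc := WG Wc.
rewrite -(BformP p_pr iota) ?(trace_AS p_pr pchark) //.
  by apply: (GF_sum p_pr pchark m_gt0) => i _; rewrite GFM ?GFX ?(Bcoef_GF p_pr iota).
by rewrite -(mem_W p_pr p_odd iota ah_neq0).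
Qed.

(** With N and N0 the two numbers of zeros and q = p^m, this is p N - q = p^h (p N0 - q), written
    without subtraction. *)
Lemma count_quotient : exists2 kappa,
  kappa \in GF m /\ kappa * \prod_(c <- V | c != 0) c = a ord_max &
  (p * count (fun x => trace p m (x * R.[x])%R == 0%R) (GF m) + p ^ h * p ^ m
    = p ^ h * (p * qcount p m (kappa / 2)%R) + p ^ m)%N.
Proof.
have VG : {subset V <= GF m} by move=> x /VW /WG.
have h_m : (h < m)%N.
  have : (size W <= size (GF m))%N by apply: uniq_leq_size WG; apply: zeros_uniq.
  rewrite (size_W p_pr p_odd iota ah_neq0) // (size_GF p_pr pchark) // leq_exp2l //.
  by apply: leq_trans; rewrite -[X in (X < _)%N]addn0 ltn_add2l.
have [kappa [G [Gk k_prod GG quot]]] :=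
  quotient_curve p_pr p_odd iota ah_neq0 h_gt0 V_grp VW V_iso size_V m_gt0 Ga VG h_m.
exists kappa => //.
have n2 : (2 : k) != 0 := natr2_neq0 p_odd pchark.
have k0 : kappa != 0 by apply: contraNneq ah_neq0 => k0; rewrite -k_prod k0 mul0r.
have f_GF x := @subspace_poly_GF p k p_pr pchark V m x m_gt0 VG.
have fD : {morph horner f : x y / x + y} := subspace_polyD p_pr V_grp size_V.
have ker_f s : uniq s -> {subset V <= s} -> count (fun x => f.[x] == 0) s = (p ^ h)%N.
  move=> s_uniq Vs; rewrite -size_filter -size_V; have [V_uniq _ _] := V_grp.
  apply/perm_size/uniq_perm; rewrite ?filter_uniq // => x.
  rewrite mem_filter -rootE root_subspace_poly; apply: andb_idr; exact: Vs.
have G_grp := GF_grp p_pr pchark m_gt0; have [G_uniq _ _] := G_grp.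
have W_grp := W_grp p_pr p_odd iota ah_neq0; have [W_uniq _ _] := W_grp.
pose a' := kappa / 2; pose Q z := trace p m (a' * z ^+ 2).
pose b y z := trace p m (kappa * y * z).
have Qf x : x \in GF m -> Q f.[x] = trace p m (x * R.[x]).
  by move=> Gx; rewrite quot traceD // (trace_AS p_pr pchark) ?addr0 ?GG.
have Ga' : a' \in GF m by rewrite GFM ?GFV ?(GF_nat p_pr pchark m_gt0 2).
have bDl y : {morph b^~ y : x x' / x + x'}.
  by move=> x x'; rewrite /b mulrDr mulrDl traceD.
have bDr x : {morph b x : y y' / y + y'}.
  by move=> y y'; rewrite /b mulrDr traceD.
have QD x y : Q (x + y) = Q x + Q y + b x y.
  by rewrite /Q /b -!traceD //; congr (trace p m _); rewrite /a'; field.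
pose U := undup [seq f.[w] | w <- W]; pose I := undup [seq f.[x] | x <- GF m].
have U_grp : subgroup_seq U := subgroup_image W_grp fD.
have UG : {subset U <= GF m}.
  by move=> u; rewrite mem_undup => /mapP[w Ww ->]; apply/f_GF/WG.
have size_U : size U = (p ^ h)%N.
  have := size_morphD_image W_grp fD; rewrite ker_f // -/U.
  rewrite (size_W p_pr p_odd iota ah_neq0) // expnD => /eqP.
  by rewrite eqn_pmul2r ?expn_gt0 ?p_gt0 // => /eqP.
have size_I : (size I * p ^ h = p ^ m)%N.
  by have := size_morphD_image G_grp fD; rewrite ker_f // -/I (size_GF p_pr pchark).
(* The polar form at f(x) and f(w) is the trace of w R(x) + R(w) x = B_w(x)^p - B_w(x), where B_w(x)
   lies in F_q because w does. *)
have bUI x w : x \in GF m -> w \in W -> b f.[x] f.[w] = 0.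
  move=> Gx Ww; have Gw := WG Ww.
  have := QD f.[x] f.[w]; rewrite -fD !Qf ?GFD // => E.
  apply: (addrI (trace p m (x * R.[x]) + trace p m (w * R.[w]))); rewrite -E.
  rewrite -(trace_AS_form Ww Gx) -!traceD //; congr (trace p m _).
  by rewrite (RpolyD _ p_pr iota); ring.
have QU u : u \in U -> Q u = 0.
  rewrite mem_undup => /mapP[w Ww ->]; apply: (mulfI n2); rewrite mulr0.
  rewrite -(bUI w w (WG Ww) Ww) mulr_natl mulr2n /Q /b -traceD //.
  by congr (trace p m _); rewrite /a'; field.
have bp x y : x \in GF m -> y \in U -> b x y ^+ p = b x y.
  by move=> Gx /UG Gy; apply: trace_Fp => //; rewrite !GFM.
have b_nd y : y \in U -> y != 0 -> exists2 x, x \in GF m & b x y != 0.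
  move=> /UG Gy y0; have Gn : kappa * y \in GF m by rewrite GFM.
  have [|x Gx trx] := trace_nondeg p_pr pchark m_gt0 Gn; first by rewrite mulf_neq0.
  by exists x; rewrite // /b mulrAC.
have Qp x : x \in GF m -> Q x ^+ p = Q x.
  by move=> Gx; rewrite trace_Fp // GFM // GFX.
have E1 := size_perp p_pr pchark G_grp U_grp bDl bDr bp b_nd.
have E2 := count_isotropic p_pr pchark G_grp U_grp UG bDl bDr bp Qp QD QU.
rewrite size_U (size_GF p_pr pchark) // in E1 E2.
set P := fun x => all _ U in E1 E2.
(* f(F_q) is orthogonal to f(W), and by duality it has as many elements, p^(m - h), as the
   orthogonal of f(W). *)
have perpE : I =i [seq x <- GF m | P x].
  have [||_ //] := @uniq_min_size _ I [seq x <- GF m | P x] (undup_uniq _).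
    move=> y; rewrite mem_undup => /mapP[x Gx ->]; rewrite mem_filter f_GF // andbT.
    by apply/allP => u; rewrite mem_undup => /mapP[w Ww ->]; rewrite bUI.
  by rewrite size_filter -(leq_pmul2r (m := p ^ h)) ?expn_gt0 ?p_gt0 // size_I -E1.
have E3 : count (fun x => trace p m (x * R.[x]) == 0) (GF m)
    = (p ^ h * count (fun x => P x && (Q x == 0%R)) (GF m))%N.
  rewrite (@eq_in_count _ _ (fun x => Q f.[x] == 0)) => [|x Gx]; last by rewrite Qf.
  rewrite (@count_comp _ _ (horner f) (fun z => Q z == 0) G_uniq f_GF).
  rewrite -sum1_count big_distrr /= big_mkcond [RHS]big_mkcond big_seq [RHS]big_seq.
  apply: eq_bigr => z Gz.
  have -> : P z = (z \in I) by rewrite perpE mem_filter Gz andbT.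
  rewrite mem_undup muln1; case: (Q z == 0); rewrite ?andbF // andbT.
  case: ifP => [/mapP[x Gx ->]|Iz].
    by rewrite (count_fibre G_grp fD Gx) ker_f.
  apply/eqP; rewrite -leqn0 leqNgt -has_count; apply/negP => /hasP[x Gx /eqP fx].
  by rewrite -fx map_f in Iz.
have E1' : (count P (GF m) * p ^ h = p ^ m)%N by rewrite E1.
rewrite E3; move: E2 E1'; rewrite -/(qcount p m a').
move: (count P (GF m)) (count (fun x => P x && _) (GF m)) (qcount p m a') (p ^ h)%N (p ^ m)%N.
move=> cP c0 N0 ph q E2 E1'.
have : (ph * (p * N0 + cP) = ph * (p * c0 + q))%N by rewrite E2.
rewrite !mulnDr [(ph * cP)%N]mulnC E1' => ->; lia.
Qed.

End PointCount.

(** * Maximal abelian subgroups of P *)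

Section AutGroup.

Variables (p : nat) (k : closedFieldType) (h : nat) (a : 'I_h.+1 -> k).
Hypotheses (p_pr : prime p) (p_odd : odd p) (iota : {rmorphism 'F_p -> k}).
Hypotheses (ah_neq0 : a ord_max != 0).

Let pchark : p \in [pchar k] := rmorph_pchar iota (pchar_Fp p_pr).

Local Notation P := (autP p_pr p_odd iota ah_neq0).
Local Notation R := (Rpoly p a).
Local Notation W := (zeros (Epoly p a)).

Lemma aut_cM (u v : P) : aut_c (u * v)%g = aut_c v + aut_c u.
Proof. by []. Qed.

Lemma aut_bM (u v : P) :
  aut_b (u * v)%g = aut_b v + aut_b u + Bform p a (aut_c u) (aut_c v).
Proof. by rewrite -(Bform_horner p_pr iota (aut_cP u)). Qed.

Lemma commute_eps (u v : P) : commute u v <-> eps p a (aut_c u) (aut_c v) = 0.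
Proof.
have autE (w w' : P) : aut_b w = aut_b w' -> aut_c w = aut_c w' -> w = w'.
  move=> Eb Ec; apply: val_inj.
  by rewrite [LHS]surjective_pairing [RHS]surjective_pairing; congr (_, _).
rewrite /eps; split=> [uv|/eqP].
  have := congr1 (@aut_b _ _ _ _ _ _ _ _) uv; rewrite !aut_bM [aut_b v + _]addrC.
  by move/addrI ->; rewrite subrr.
rewrite subr_eq0 => /eqP Euv; apply: autE; rewrite ?aut_bM ?aut_cM; last exact: addrC.
by rewrite Euv [aut_b v + _]addrC.
Qed.

Variable A : {group P}.
Hypothesis A_max : [max A | abelian A]%g.

Lemma mem_aut_image c : reflect (exists2 u, u \in A & c = aut_c u) (c \in aut_image A).
Proof.
rewrite mem_undup; apply: (iffP imageP) => -[u Au ->]; exists u => //.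
Qed.

Lemma aut_image_grp : subgroup_seq (aut_image A).
Proof.
split; first exact: undup_uniq.
  by apply/mem_aut_image; exists 1%g; rewrite ?group1.
move=> x y /mem_aut_image[u Au ->] /mem_aut_image[v Av ->].
apply/mem_aut_image; exists (u * v^-1)%g; first by rewrite groupM ?groupV.
by rewrite aut_cM addrC.
Qed.

Lemma aut_image_sub : {subset aut_image A <= W}.
Proof.
move=> x /mem_aut_image[u Au ->].
by rewrite (mem_W p_pr p_odd iota ah_neq0) aut_cP.
Qed.

Lemma aut_image_iso : {in aut_image A &, forall x y, eps p a x y = 0}.
Proof.
have /maxgroupP[abA _] := A_max.
move=> x y /mem_aut_image[u Au ->] /mem_aut_image[v Av ->].
by apply/commute_eps/(centsP abA).
Qed.

(** An element of P above x, which exists as k is algebraically closed, centralizes A; together with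
    A it generates an abelian group, equal to A by maximality. *)
Lemma aut_image_max x :
  x \in W -> (forall y, y \in aut_image A -> eps p a x y = 0) -> x \in aut_image A.
Proof.
rewrite (mem_W p_pr p_odd iota ah_neq0) => Wx Vx.
have [b Eb] : exists b, b ^+ p - b = x * R.[x].
  have [|b] := closed_rootP ('X^p - 'X - (x * R.[x])%:P : {poly k}) _.
    rewrite -addrA -opprD size_polyDl size_polyXn ?size_polyN ?size_XaddC.
      by rewrite eqSS -lt0n prime_gt0.
    by rewrite ltnS prime_gt1.
  by rewrite rootE !hornerE subr_eq0 => /eqP; exists b.
have Pbx : aut_pair p a (b, x) by rewrite /aut_pair /= Wx Eb eqxx.
pose u : P := Sub (b, x) Pbx.
have /maxgroupP[abA maxA] := A_max.
have cAu : u \in 'C(A)%g.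
  apply/centP => v Av; apply/commute_eps; apply: Vx.
  by apply/mem_aut_image; exists v.
have abAu : abelian (A <*> <[u]>)%g.
  by rewrite abelianY abA cycle_abelian cycle_subG.
have EA := maxA _ abAu (joing_subl _ _).
apply/mem_aut_image; exists u => //.
by rewrite -EA; apply: (subsetP (joing_subr A <[u]>%G)); apply: cycle_id.
Qed.

Lemma size_aut_image : (0 < h)%N -> size (aut_image A) = (p ^ h)%N.
Proof.
move=> h_gt0; apply: (size_Lagrangian p_pr p_odd iota ah_neq0 h_gt0).
- exact: aut_image_grp.
- exact: aut_image_sub.
- exact: aut_image_iso.
- exact: aut_image_max.
Qed.

End AutGroup.

(** * From numbers of points to L-polynomials *)

Lemma coef_dvdXn (F : fieldType) (f : {poly F}) n i :
  'X^n %| f -> (i < n)%N -> f`_i = 0.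
Proof. by case/dvdpP => g -> lt_i; rewrite coefMXn lt_i. Qed.

Lemma dvdXn_coef (F : fieldType) (f : {poly F}) n :
  (forall i, (i < n)%N -> f`_i = 0) -> 'X^n %| f.
Proof.
move=> f0; apply/dvdpP; exists (\poly_(i < size f - n) f`_(i + n)).
apply/polyP => i; rewrite coefMXn coef_poly; case: ltnP => [/f0 //|le_i].
case: ltnP => // le; first by rewrite subnK.
by rewrite nth_default //; rewrite leq_subLR subnKC in le.
Qed.

Section Zeta.

Variables (N : nat -> nat).

Definition log_zeta n : {poly rat} :=
  \sum_(1 <= m < n.+1) ((N m)%:R / m%:R) *: 'X^m.

Definition trunc_exp n (f : {poly rat}) : {poly rat} :=
  \sum_(0 <= j < n.+1) (j`!%:R)^-1 *: f ^+ j.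

Lemma dvdX_log_zeta n : 'X %| log_zeta n.
Proof.
rewrite /log_zeta big_seq; apply: (big_ind (fun f => 'X %| f)); rewrite ?dvdp0 //.
  exact: dvdp_add.
move=> m; rewrite mem_index_iota => /andP[m_gt0 _].
by rewrite -(prednK m_gt0) exprS scalerAr dvdp_mulr.
Qed.

Lemma dvdXn_log_zeta n j : 'X^j %| log_zeta n ^+ j.
Proof. exact/dvdp_exp2r/dvdX_log_zeta. Qed.

(** A longer truncation adds to the logarithm only multiples of X^(i + 1), and to the exponential
    only powers, of exponent above i, of a multiple of X. So one polynomial serves for all
    coefficients up to n. *)
Lemma zeta_coefE n i : (i <= n)%N -> zeta_coef N i = (trunc_exp n (log_zeta n))`_i.
Proof.
move=> le_in; rewrite /zeta_coef -/(log_zeta i) -/(trunc_exp i _).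
apply/esym/eqP; rewrite -subr_eq0 -coefB; apply/eqP.
apply: (@coef_dvdXn _ _ i.+1) => //.
have Eln : 'X^(i.+1) %| log_zeta n - log_zeta i.
  apply: dvdXn_coef => l lt_l; rewrite coefB /log_zeta (big_cat_nat (n := i.+1)) //=.
  rewrite coefD addrAC subrr add0r coef_sum big_seq big1 // => m.
  rewrite mem_index_iota => /andP[le_m _]; rewrite coefZ coefXn ltn_eqF ?mulr0 //.
  exact: leq_trans lt_l le_m.
rewrite /trunc_exp (big_cat_nat (n := i.+1)) //= addrAC -sumrB.
rewrite dvdp_addr; last first.
  rewrite big_seq; apply: (big_ind (fun f => 'X^(i.+1) %| f)); rewrite ?dvdp0 //.
    exact: dvdp_add.
  by move=> j _; rewrite -scalerBr subrXX dvdpZr ?dvdp_mulr // invr_eq0 pnatr_eq0 -lt0n fact_gt0.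
rewrite big_seq; apply: (big_ind (fun f => 'X^(i.+1) %| f)); rewrite ?dvdp0 //.
  exact: dvdp_add.
move=> j; rewrite mem_index_iota => /andP[lt_j _].
rewrite dvdpZr ?invr_eq0 ?pnatr_eq0 -?lt0n ?fact_gt0 //.
by apply: dvdp_trans (dvdXn_log_zeta n j); rewrite dvdp_exp2l.
Qed.

(** The differential equation of exp with its truncation error, which is divisible by X^n when X
    divides f. *)
Lemma deriv_trunc_exp n f : 
  (trunc_exp n f)^`() = f^`() * trunc_exp n f - (n`!%:R)^-1 *: (f^`() * f ^+ n).
Proof.
elim: n => [|n IHn].
  by rewrite /trunc_exp big_nat1 expr0 derivZ derivC scaler0 -scalerAr subrr.
have ES : trunc_exp n.+1 f = trunc_exp n f + (n.+1`!%:R)^-1 *: f ^+ n.+1.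
  by rewrite /trunc_exp big_nat_recr.
have dfn : (f ^+ n.+1)^`() = n.+1%:R *: (f^`() * f ^+ n).
  by rewrite deriv_exp -scaler_nat.
have n0 : n.+1%:R != 0 :> rat by rewrite pnatr_eq0.
rewrite ES derivD IHn derivZ dfn scalerA.
have -> : (n.+1`!%:R)^-1 * n.+1%:R = (n`!%:R)^-1 :> rat.
  by rewrite factS natrM invfM mulrAC mulVf // mul1r.
by rewrite subrK mulrDr -scalerAr addrK.
Qed.

Lemma deriv_log_zeta n : (log_zeta n)^`() = \sum_(i < n) (N i.+1)%:R *: 'X^i.
Proof.
rewrite /log_zeta raddf_sum /= big_add1 /= big_mkord; apply: eq_bigr => i _.
by rewrite derivZ derivXn -scaler_nat scalerA divfK // pnatr_eq0.
Qed.

(* A power series solution of the equation [K' U = V K] is determined by its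
   constant term; only the terms of degree at most [n] matter here. *)
Lemma ode_unique (K U V : {poly rat}) n :
  K`_0 = 0 -> U`_0 = 1 -> 'X^n %| K^`() * U - V * K ->
  forall i, (i <= n)%N -> K`_i = 0.
Proof.
move=> K0 U0 dvdK i; have [l] := ubnP i; elim: l i => // l IHl [//|i] lt_i le_i.
have Kj j : (j <= i)%N -> K`_j = 0 by move=> le_j; apply: IHl; lia.
have := coef_dvdXn dvdK le_i; rewrite coefB !coefM big_ord_recr /= subnn U0 mulr1.
rewrite big1 => [|j _]; last first.
  by rewrite coef_deriv Kj ?mul0rn ?mul0r // ltn_ord.
rewrite big1 => [|j _]; last by rewrite Kj ?mulr0 // leq_subr.
by rewrite add0r subr0 coef_deriv => /eqP; rewrite mulrn_eq0 => /eqP.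
Qed.

(** The reciprocal roots of L are the d-th roots of w, each M times; their n-th powers add up to d M
    w^(n / d) if d divides n, and to 0 otherwise. *)
Lemma is_LpolyP (q d M : nat) (w : int) : (0 < d)%N ->
  (forall n, (0 < n)%N -> ((N n)%:Z = (q ^ n)%:Z + 1
     - (if (d %| n)%N then (d * M)%:Z * w ^+ (n %/ d) else 0))) ->
  is_Lpoly q N ((1 - w *: 'X^d) ^+ M).
Proof.
move=> d_gt0 NE n; pose wr : rat := w%:~R; pose qr : rat := q%:R.
pose D : {poly rat} := (1 - 'X) * (1 - qr *: 'X).
pose P := log_zeta n; pose E := trunc_exp n P.
transitivity ((E * D)`_n).
  rewrite coefM; apply: eq_bigr => i _; congr (_ * _).
  by rewrite (@zeta_coefE n) // -ltnS.
pose U : {poly rat} := 1 - wr *: 'X^d; pose L := U ^+ M.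
have -> : (((1 - w *: 'X^d) ^+ M)`_n)%:~R = L`_n :> rat.
  rewrite -coef_map rmorphXn /= rmorphB /= rmorph1.
  by rewrite map_polyZ /= map_polyXn.
pose c : rat := (d * M)%:R; pose V : {poly rat} := - (c * wr) *: 'X^(d.-1).
have dL : L^`() * U = V * L.
  rewrite /L deriv_exp; case: (posnP M) => [M0|M_gt0].
    by rewrite /V /c M0 muln0 mulr0n (mul0r wr) oppr0 scale0r !mul0r.
  rewrite -mulrnAl -mulrA -exprSr prednK //; congr (_ * _).
  rewrite /U derivB derivC derivZ derivXn sub0r /V /c.
  rewrite natrM scaleNr mulNrn; congr (- _).
  by rewrite -scalerMnr -mulrnA -[_ *+ (d * M)]scaler_nat scalerA natrM mulrC.
have U0 : U`_0 = 1.
  by rewrite coefB coef1 coefZ coefXn (ltn_eqF d_gt0) mulr0 subr0.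
(* Power sums of the reciprocal roots. Their generating series is - L' / L = - V / U, and T is its
   truncation. *)
pose t m : rat := if (d %| m)%N then c * wr ^+ (m %/ d) else 0.
pose T : {poly rat} := \sum_(i < n) t i.+1 *: 'X^i.
have dvdT : 'X^n %| T * U + V.
  apply: dvdXn_coef => i lt_i; rewrite mulrBr mulr1 -scalerAr coefD coefB !coefZ.
  have coefT j : (j < n)%N -> T`_j = t j.+1.
    move=> lt_j; rewrite coef_sum (bigD1 (Ordinal lt_j)) //= coefZ coefXn eqxx mulr1.
    rewrite big1 ?addr0 // => l lj; rewrite coefZ coefXn eq_sym.
    by rewrite (negPf (lj : val l != j)) mulr0.
  rewrite coefMXn coefXn coefT // /t; case: ltnP => [lt_id|le_di].
    rewrite mulr0 subr0; have [->|i_d] := eqVneq i d.-1.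
      by rewrite prednK // dvdnn divnn d_gt0 expr1 mulr1 subrr.
    rewrite mulr0 addr0 ifF //; apply/negP => /dvdn_leq => /(_ isT) le_d.
    by move: i_d; rewrite -eqSS prednK // eqn_leq le_d lt_id.
  have lt_j : (i - d < n)%N by apply: leq_ltn_trans (leq_subr _ _) lt_i.
  rewrite coefT // /t -subSn // gtn_eqF ?mulr0 ?addr0; last by rewrite prednK.
  have -> : i.+1 = (i.+1 - d + d)%N by rewrite subnK // leqW.
  rewrite addnK dvdn_addl // divnDr // divnn d_gt0 addn1 exprS.
  by case: ifP => _; [ring|rewrite mulr0 subrr].
(* Truncations of 1 / (1 - X) and q / (1 - q X), the shares of 1 and q^n in the numbers of
   points. *)
pose A1 : {poly rat} := \sum_(i < n) 'X^i.
pose Aq : {poly rat} := \sum_(i < n) qr ^+ i.+1 *: 'X^i.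
have A1E : (1 - 'X) * A1 = 1 - 'X^n.
  rewrite -[1 in RHS](expr1n _ n) subrXX; congr (_ * _).
  by apply: eq_bigr => i _; rewrite expr1n mul1r.
have AqE : (1 - qr *: 'X) * Aq = qr *: (1 - (qr *: 'X) ^+ n).
  rewrite -{2}(expr1n _ n) subrXX scalerAr; congr (_ * _); rewrite scaler_sumr.
  by apply: eq_bigr => i _; rewrite expr1n mul1r exprZn scalerA exprS.
have dP : P^`() = A1 + Aq - T.
  rewrite deriv_log_zeta -big_split -sumrB; apply: eq_bigr => i _ /=.
  rewrite -[X in _ = X + _ - _]scale1r -scalerDl -scalerBl; congr (_ *: _).
  rewrite [LHS]pmulrn NE // rmorphB rmorphD /=.
  rewrite /t /c /wr /qr; congr (_ - _); first by rewrite -natrX addrC.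
  by case: ifP => _ //; rewrite rmorphM rmorphXn.
have dD : D^`() = - (1 - qr *: 'X) - qr *: (1 - 'X).
  rewrite /D derivM !derivB derivC derivZ derivX -!mul_polyC; ring.
have dE := deriv_trunc_exp n P; rewrite -/E in dE.
apply/eqP; rewrite -subr_eq0 -coefB; apply/eqP.
apply: (@ode_unique _ U V n) => //.
  rewrite coefB coef0M.
  have -> : E`_0 = 1.
    rewrite /E /trunc_exp big_nat_recl // coefD coefZ expr0 coef1 fact0 invr1 mulr1.
    rewrite coef_sum big1_seq ?addr0 // => j _.
    rewrite coefZ (@coef_dvdXn _ _ j.+1) ?mulr0 //; exact: dvdXn_log_zeta.
  have -> : D`_0 = 1.
    by rewrite coef0M !coefB !coef1 coefX coefZ coefX mulr0 !subr0 mulr1.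
  by rewrite /L -horner_coef0 horner_exp horner_coef0 U0 expr1n mulr1 subrr.
(* Three errors remain, each divisible by X^n: the truncation of exp, the tails of the geometric
   series, and T U + V. *)
have -> : (E * D - L)^`() * U - V * (E * D - L)
    = - (n`!%:R)^-1 *: (P^`() * P ^+ n) * D * U
      - E * U * ('X^n * (1 - qr *: 'X) + qr *: (qr *: 'X) ^+ n * (1 - 'X))
      - E * D * (T * U + V).
  rewrite derivB derivM dE dD mulrBl dL dP.
  transitivity (- (n`!%:R)^-1 *: ((A1 + Aq - T) * P ^+ n) * D * U
     + E * U * (((1 - 'X) * A1) * (1 - qr *: 'X) + ((1 - qr *: 'X) * Aq) * (1 - 'X)
       - (1 - qr *: 'X) - qr *: (1 - 'X)) - E * D * (T * U + V)).
    by rewrite /D scaleNr; ring.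
  by rewrite A1E AqE scalerBr -!mul_polyC; ring.
apply: dvdp_sub; last by rewrite dvdp_mull.
apply: dvdp_sub.
  rewrite -mulrA dvdp_mulr // dvdpZr ?dvdp_mull //.
    exact: dvdXn_log_zeta.
  by rewrite oppr_eq0 invr_eq0 pnatr_eq0 -lt0n fact_gt0.
rewrite dvdp_mull // dvdp_add ?dvdp_mulr //.
by rewrite exprZn scalerA -mul_polyC dvdp_mull.
Qed.

End Zeta.

(** * The L-polynomial of C_R *)

(* p^* = p or - p is the square of the quadratic Gauss sum over F_p. *)
Definition pstar (p : nat) : int := (-1) ^+ odd p.-1./2 * p%:Z.

(** The parity of (x - 1) / 2 is the nontrivial character modulo 4 on odd x, written additively. *)
Lemma odd_half_predM x y : odd x -> odd y ->
  odd (x * y).-1./2 = odd x.-1./2 (+) odd y.-1./2.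
Proof.
move=> x_odd y_odd.
have -> : x = (x.-1./2).*2.+1 by lia.
have -> : y = (y.-1./2).*2.+1 by lia.
move: x.-1./2 y.-1./2 => u v.
have -> : (u.*2.+1 * v.*2.+1).-1 = (2 * (u * v) + u + v).*2 by lia.
by rewrite mul2n /= !doubleK !oddD odd_double.
Qed.

Lemma pstarX p j : odd p -> pstar p ^+ j = (-1) ^+ odd (p ^ j).-1./2 * (p ^ j)%:Z.
Proof.
move=> p_odd; elim: j => [|j IHj]; first by rewrite !expr0 mul1r.
rewrite exprS IHj /pstar expnS odd_half_predM ?oddX ?p_odd ?orbT //.
by rewrite signr_addb PoszM; ring.
Qed.

Section CurvePoints.

Variables (p : nat) (k : closedFieldType) (h : nat) (a : 'I_h.+1 -> k).
Hypotheses (p_pr : prime p) (p_odd : odd p) (iota : {rmorphism 'F_p -> k}).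
Hypothesis ah_neq0 : a ord_max != 0.

Let pchark : p \in [pchar k] := rmorph_pchar iota (pchar_Fp p_pr).
Let p_gt0 : (0 < p)%N := prime_gt0 p_pr.
Let p_gt1 : (1 < p)%N := prime_gt1 p_pr.

Local Notation R := (Rpoly p a).
Local Notation W := (zeros (Epoly p a)).
Local Notation GF := (GF p k).

Variable A : {group autP p_pr p_odd iota ah_neq0}.
Hypothesis A_max : [max A | abelian A]%g.

Lemma aut_image_prod_neq0 : \prod_(c <- aut_image A | c != 0) c != 0.
Proof. by elim/big_ind: _ => // [|x y]; [apply: oner_neq0|apply: mulf_neq0]. Qed.

Lemma aut_const_neq0 : aut_const A != 0.
Proof.
rewrite /aut_const; case: (h == 0%N) => //.
by rewrite !mulf_neq0 ?aut_image_prod_neq0 // invr_eq0 (natr2_neq0 p_odd pchark).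
Qed.

Section Rational.

Variable m : nat.
Hypotheses (m_gt0 : (0 < m)%N) (Ga : forall i, a i \in GF m).
Hypothesis WG : {subset W <= GF m}.

Lemma aut_image_prod_GF : \prod_(c <- aut_image A | c != 0) c \in GF m.
Proof.
rewrite big_seq_cond; elim/big_ind: _ => [|x y|c /andP[Ac _]].
- exact: (GF_nat p_pr pchark m_gt0 1).
- exact: GFM.
- by apply/WG/(aut_image_sub Ac).
Qed.

Lemma aut_const_GF : aut_const A \in GF m.
Proof.
rewrite /aut_const; case: eqP => // _.
by rewrite !GFM ?GFV ?(GF_nat p_pr pchark m_gt0 2) ?aut_image_prod_GF.
Qed.

Lemma count_trace_curve :
  (p * count (fun x => trace p m (x * R.[x])%R == 0%R) (GF m) + p ^ h * p ^ m
    = p ^ h * (p * qcount p m (aut_const A)) + p ^ m)%N.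
Proof.
have [h0|h_gt0] := posnP h; last first.
  have [kappa [Gk k_prod] ->] := count_quotient p_pr p_odd iota ah_neq0 h_gt0
    (aut_image_grp A) (@aut_image_sub _ _ _ _ _ _ _ _ A) (aut_image_iso A_max)
    (size_aut_image A_max h_gt0) m_gt0 Ga WG.
  have -> : aut_const A = kappa / 2 * (\prod_(c <- aut_image A | c != 0) c) ^+ 2.
    by rewrite /aut_const gtn_eqF // -k_prod; ring.
  by rewrite (qcount_sqr p_pr) ?aut_image_prod_GF ?aut_image_prod_neq0.
(* For h = 0, x R(x) is already a_0 x^2 and there is no quotient to take. *)
have ph1 : (p ^ h = 1)%N by rewrite h0.
have -> : aut_const A = a ord_max.
  by rewrite /aut_const (_ : h == 0%N) //; apply/eqP.
rewrite ph1 !mul1n; congr (_ * _ + _)%N; apply: eq_count => x; rewrite RpolyE.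
have -> : \sum_(i < h.+1) a i * x ^+ (p ^ i) = a ord_max * x.
  rewrite big_ord_recr /= ph1 expr1 big1 ?add0r // => i _.
  by have := ltn_ord i; rewrite [X in (_ < X)%N]h0.
by rewrite mulrCA.
Qed.

(** The parity of (p^(m / 2) - 1) / 2 from [qcount_even] is absorbed by the sign of
    [pstar p ^+ m./2], which makes the deviation a pure power in m. *)
Lemma size_curve_points_sign (b : bool) t : t ^+ 2 = aut_const A ->
  t ^+ (p ^ m) = (-1) ^+ b * t ->
  (size (curve_points p a m))%:Z = (p ^ m)%:Z + 1
    - (if odd m then 0 else (p ^ h * p.-1)%:Z * ((-1) ^+ b * pstar p ^+ m./2)).
Proof.
move=> Dt tq; rewrite size_curve_points // -addn1 PoszD.
have aA0 := aut_const_neq0.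
have t0 : t != 0 by apply: contraNneq aA0 => t0; rewrite -Dt t0 expr0n.
have := count_trace_curve; case: ifP => [m_odd|/negbT m_even].
  rewrite (qcount_odd p_pr p_odd pchark m_odd aut_const_GF aA0); lia.
have j_gt0 : (0 < m./2)%N by lia.
have Dm : m = m./2.*2 by rewrite even_halfK.
have := qcount_even p_pr p_odd pchark j_gt0 Dm t0 tq; rewrite Dt pstarX // => Q E.
have -> : (-1) ^+ b * ((-1) ^+ odd (p ^ m./2).-1./2 * (p ^ m./2)%:Z)
    = (-1) ^+ (b (+) odd (p ^ m./2).-1./2) * (p ^ m./2)%:Z :> int.
  by rewrite signr_addb mulrA.
move: Q E; case: (b (+) _);
  move: (p ^ m./2)%N (p ^ m)%N (p ^ h)%N (qcount _ _ _) (count _ _) p.-1.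
  move=> x y z u v w /= Q E; rewrite Q in E.
  have -> : (p * v = y + z * (w * x))%N by nia.
  rewrite expr1; lia.
move=> x y z u v w /= Q E.
have : (p * v + z * (w * x) = y)%N by nia.
rewrite expr0; lia.
Qed.

End Rational.

Variable s : nat.
Hypotheses (s_gt0 : (0 < s)%N) (Ga : forall i, a i \in GF s).
Hypothesis WG : {subset W <= GF s}.

(** Over the extension of degree n, Frobenius multiplies a square root of a_A by (-1)^(b n): a
    nonsquare becomes a square exactly when n is even. *)
Lemma aut_const_sign : exists b : bool,
  (b = false <-> square_in p s (aut_const A)) /\
  forall n, (0 < n)%N -> (size (curve_points p a (s * n)))%:Z = ((p ^ s) ^ n)%:Z + 1
    - (if odd (s * n) then 0
       else (p ^ h * p.-1)%:Z * (((-1) ^+ b) ^+ n * pstar p ^+ (s * n)./2)).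
Proof.
have [t Dt] := exists_nth_root (aut_const A) (isT : (0 < 2)%N).
have Gt2 : t ^+ 2 \in GF s by rewrite Dt aut_const_GF.
have t0 : t != 0 by apply: contraNneq aut_const_neq0 => t0; rewrite -Dt t0 expr0n.
have [b tq] : exists b : bool, t ^+ (p ^ s) = (-1) ^+ b * t.
  have : (t ^+ (p ^ s) == t) || (t ^+ (p ^ s) == - t).
    by rewrite -eqf_sqr exprAC (GF_expE p_pr s_gt0 Gt2).
  by case/orP=> /eqP ->; [exists false; rewrite mul1r|exists true; rewrite mulN1r].
exists b; split.
  split=> [b0|[z [Gz z0 Dz]]].
    by exists t; split=> //; rewrite mem_GF // tq b0 mul1r.
  case: b tq => // tq; have := GFN p_pr pchark s_gt0 Gz; move: Gz.
  have : (t == z) || (t == - z) by rewrite -eqf_sqr Dt Dz.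
  by case/orP=> /eqP <- => [+ _|_ +]; rewrite mem_GF // tq mulN1r eq_sym
    (eq_opp p_odd pchark) (negPf t0).
move=> n n_gt0; have sn_gt0 : (0 < s * n)%N by rewrite muln_gt0 s_gt0.
have Gsn : {subset GF s <= GF (s * n)} := GF_dvd p_pr s_gt0 sn_gt0 (dvdn_mulr n (dvdnn s)).
have tqn : t ^+ (p ^ (s * n)) = (-1) ^+ (b && odd n) * t.
  rewrite expnM; elim: n {n_gt0 sn_gt0 Gsn} => [|n IHn].
    by rewrite andbF expr1 mul1r.
  rewrite expnSr exprM IHn exprMn tq mulrA; congr (_ * _).
  have -> : ((-1) ^+ (b && odd n) : k) ^+ (p ^ s) = (-1) ^+ (b && odd n).
    case: (b && odd n); rewrite ?expr0 ?expr1n // expr1 -[LHS]signr_odd.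
    by rewrite oddX p_odd orbT.
  by rewrite -signr_addb /=; case: b (odd n) {tq IHn} => -[].
rewrite (size_curve_points_sign sn_gt0 _ _ Dt tqn) => [|i|x /WG]; [|exact: Gsn..].
rewrite expnM; congr (_ - _); case: ifP => // _; congr (_ * (_ * _)).
by case: (b); rewrite ?expr1n //= signr_odd.
Qed.

(** For odd s only even n contribute, the pattern of d = 2 in [is_LpolyP]: the reciprocal roots are
    the two square roots of [pstar p ^+ s]. For even s all 2g of them coincide and d = 1. *)
Lemma curve_Lpoly (g := ((p ^ h * p.-1)./2)%N) : exists b : bool,
  (b = false <-> square_in p s (aut_const A)) /\
  is_curve_Lpoly p a s
    (if odd s then (1 - pstar p ^+ s *: 'X^2) ^+ g
     else (1 - ((-1) ^+ b * pstar p ^+ s./2) *: 'X) ^+ (2 * g)).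
Proof.
have [b [b_sq NE]] := aut_const_sign; exists b; split=> //.
have Dg : (p ^ h * p.-1 = 2 * g)%N.
  have p1_even : odd (p ^ h * p.-1) = false by rewrite oddM; lia.
  rewrite /g; lia.
have [s_odd|s_even] := boolP (odd s).
  apply: is_LpolyP => // n n_gt0; rewrite NE // Dg; congr (_ - _).
  rewrite oddM s_odd dvdn2 /=; case: ifPn => // n_even; congr (_ * _).
  have -> : (s * n)./2 = (s * (n %/ 2))%N.
    by rewrite divn2 -{1}(even_halfK n_even) -doubleMr doubleK.
  by rewrite -[_ ^+ b ^+ n]exprM mulnC exprM -signr_odd (negPf n_even) expr1n mul1r exprM.
have -> : 1 - ((-1) ^+ b * pstar p ^+ s./2) *: 'X
    = 1 - ((-1) ^+ b * pstar p ^+ s./2) *: 'X^1 :> {poly int} by [].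
apply: is_LpolyP => // n n_gt0; rewrite NE // Dg mul1n dvd1n divn1.
rewrite oddM (negPf s_even) [in RHS]exprMn -[in RHS](exprM (pstar p)) /=.
congr (_ - _ * (_ * _ ^+ _)).
by rewrite -{1}(even_halfK s_even) -doubleMl doubleK.
Qed.

End CurvePoints.

Lemma splitting_field_zeros p (k : closedFieldType) r (f : {poly k}) e :
  f != 0 -> splitting_field p r f e -> {subset zeros f <= GF p k e}.
Proof.
move=> f0 [_ _ [rs Df rsG] _] x; rewrite mem_zeros // (eqp_root Df).
by rewrite root_prod_XsubC => /rsG.
Qed.

Theorem theorem8p4
  (p : nat) (p_pr : prime p) (p_odd : odd p)
  (k : closedFieldType) (iota : {rmorphism 'F_p -> k})
  (k_alg : integralRange iota)
  (h : nat) (a : 'I_h.+1 -> k) (ah_neq0 : a ord_max != 0)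
  (r : nat) (r_gt0 : (0 < r)%N) (a_GF : forall i, a i \in GF p k r)
  (e : nat) (split_e : splitting_field p r (Epoly p a) e)
  (s : nat) (s_gt0 : (0 < s)%N) (GF_es : {subset GF p k e <= GF p k s})
  (A : {group autP p_pr p_odd iota ah_neq0})
  (A_max : [max A | abelian A]%g) :
  let g := ((p ^ h * p.-1)./2)%N in
  let aA := aut_const A in
  let is_L := is_curve_Lpoly p a s in
  ((p %% 4 = 1)%N ->
    [/\ odd s -> is_L ((1 - (p ^ s)%:R *: 'X^2) ^+ g),
        ~~ odd s -> square_in p s aA ->
          is_L ((1 - (p ^ s./2)%:R *: 'X) ^+ (2 * g)%N) &
        ~~ odd s -> ~ square_in p s aA ->
          is_L ((1 + (p ^ s./2)%:R *: 'X) ^+ (2 * g)%N)]) /\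
  ((p %% 4 = 3)%N ->
    [/\ odd s -> is_L ((1 + (p ^ s)%:R *: 'X^2) ^+ g),
        (s %% 4 = 0)%N -> square_in p s aA ->
          is_L ((1 - (p ^ s./2)%:R *: 'X) ^+ (2 * g)%N),
        (s %% 4 = 0)%N -> ~ square_in p s aA ->
          is_L ((1 + (p ^ s./2)%:R *: 'X) ^+ (2 * g)%N),
        (s %% 4 = 2)%N -> square_in p s aA ->
          is_L ((1 + (p ^ s./2)%:R *: 'X) ^+ (2 * g)%N) &
        (s %% 4 = 2)%N -> ~ square_in p s aA ->
          is_L ((1 - (p ^ s./2)%:R *: 'X) ^+ (2 * g)%N)]).
Proof.
move=> g aA is_L; have [_ GF_re _ _] := split_e.
have a_GFs i : a i \in GF p k s by apply/GF_es/GF_re.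
have WGs : {subset zeros (Epoly p a) <= GF p k s}.
  move=> x /(splitting_field_zeros (Epoly_neq0 p_pr iota p_odd ah_neq0) split_e).
  exact: GF_es.
have [b [b_sq]] := curve_Lpoly A_max s_gt0 a_GFs WGs.
rewrite -/g -/aA -/is_L => Lb.
have bF : square_in p s aA -> b = false by case: b_sq.
have bT : ~ square_in p s aA -> b = true by case: b {Lb bF} b_sq => // -[+ _] => /(_ erefl).
(* The power is negative exactly when p = 3 modulo 4 and j is odd; for even s this applies to j = s
   / 2, whence the cases modulo 4. *)
have pstarE j : pstar p ^+ j = (-1) ^+ (odd p.-1./2 && odd j) * (p ^ j)%:R.
  rewrite /pstar exprMn -exprM natrX natz; congr (_ * _).
  by case: (odd _); rewrite ?expr1n ?mul0n // mul1n signr_odd.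
move: Lb; case: ifP => s_odd; rewrite pstarE => Lb.
  split=> p4; split=> //; try lia.
    by move: Lb; rewrite (_ : odd p.-1./2 = false) ?mul1r //; lia.
  move: Lb; rewrite (_ : odd p.-1./2 = true) ?s_odd; last lia.
  by rewrite mulN1r scaleNr opprK.
split=> p4.
  have e0 : odd p.-1./2 = false by lia.
  move: Lb; rewrite e0 mul1r => Lb; split=> // _ => [/bF Eb|/bT Eb]; move: Lb; rewrite Eb.
    by rewrite mul1r.
  by rewrite mulN1r scaleNr opprK.
have e1 : odd p.-1./2 = true by lia.
move: Lb; rewrite e1 /= => Lb; split; first by move=> s1; rewrite s1 in s_odd.
- move=> s4 /bF Eb; move: Lb; rewrite Eb (_ : odd s./2 = false) ?mul1r //; lia.
- move=> s4 /bT Eb; move: Lb; rewrite Eb (_ : odd s./2 = false); last lia.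
  by rewrite mul1r mulN1r scaleNr opprK.
- move=> s4 /bF Eb; move: Lb; rewrite Eb (_ : odd s./2 = true); last lia.
  by rewrite mul1r mulN1r scaleNr opprK.
move=> s4 /bT Eb; move: Lb; rewrite Eb (_ : odd s./2 = true); last lia.
by rewrite !mulN1r opprK.
Qed.
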